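(* There are a standard Borel space $X$ and countably many $2$-regular Borel graphs $\{G_i\}_{i\in\omega}$ on $X$ such that for every family $\{c_i\}_{i\in\omega}$ where each $c_i$ is a Borel $3$-coloring of $G_i$, there is an $x\in X$ such that $c_i(x)=c_j(x)$ for all $i,j\in\omega$.
   Context: A Borel graph on $X$ is a symmetric irreflexive relation on $X$ that is Borel in $X\times X$; it is $2$-regular if every vertex has exactly $2$ neighbors. A Borel $3$-coloring of a Borel graph $G$ on $X$ is a Borel function $c\colon X\to\{0,1,2\}$ with $c(x)\neq c(y)$ whenever $x,y$ are adjacent. *)

(* Defs.v *)
From HB Require Import structures.
From mathcomp Require Import all_boot all_order all_algebra.
From mathcomp Require Import all_classical all_reals all_analysis.

Set Implicit Arguments.
Unset Strict Implicit.
Unset Printing Implicit Defensive.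

Local Open Scope classical_set_scope.

HB.instance Definition _ (n : nat) := isPointed.Build 'I_n.+1 ord0.
HB.instance Definition _ (n : nat) :=
  @isMeasurable.Build default_measure_display 'I_n.+1 discrete_measurable
    discrete_measurable0 discrete_measurableC discrete_measurableU.

Definition separable_space (T : topologicalType) : Prop :=
  exists2 D : set T, countable D & dense D.

(* The library's [completeType] is pointed, while [metricType] is not; this is
   its completeness axiom, stated without a base point. *)
Definition complete_space (T : uniformType) : Prop :=
  forall F : set_system T, ProperFilter F -> cauchy F -> exists x : T, F --> x.

(* X is Borel isomorphic to a separable complete metric space equipped with
   the sigma-algebra generated by its open sets. *)
Definition standard_borel (R : realType) (d : measure_display)
    (X : measurableType d) : Prop :=
  exists (M : metricType R) (f : X -> M),
    [/\ separable_space M, complete_space M, bijective f &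
        forall A : set M, measurable (f @^-1` A) <-> <<s open >> A].

Section graphs.
Context (d : measure_display) (X : measurableType d).
Implicit Type G : set (X * X).

(* [measurable G] refers to the product sigma-algebra on X * X; when X is
   standard Borel it is the Borel sigma-algebra of the product topology. *)
Definition borel_graph G : Prop :=
  [/\ measurable G, forall x y, G (x, y) -> G (y, x) & forall x, ~ G (x, x)].

Definition two_regular G : Prop :=
  forall x, ([set y | G (x, y)] #= `I_2)%card.

Definition borel_3coloring G (c : X -> 'I_3) : Prop :=
  measurable_fun [set: X] c /\ forall x y, G (x, y) -> c x <> c y.

End graphs.

(* Main.v *)
(**
  Let Gamma be the free product of countably many copies of Z/3, one for each
  i, and let X be the space of maps x : Gamma -> (Z/3)^nat such that moving
  from w to its neighbour by the generator g_i^a adds a to the i-th coordinate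
  of x. Shifting by g_i cuts X into triangles; G_i is the graph of these
  triangles, and a 3-coloring of it takes each color once on every triangle.
  Suppose that no x has color 0 for every c_i, so that the sets
  A_i = {c_i <> 0} cover X. For each i and each root label l, player I labels
  the branches of the Cayley tree that leave the root in direction i, player
  II labels the other ones, and II wins if the resulting point is in A_i.
  If I won all these games for one l, playing the strategies for all i
  simultaneously would give a point outside every A_i. So by Borel determinacy
  every l has some i for which II wins, and a diagonal choice of l provides an
  i such that II wins for root labels l_0, l_1, l_2 with i-th coordinates
  0, 1, 2. Playing these three strategies on one triangle of G_i yields a
  triangle inside A_i, which is thus colored with two colors: contradiction.
  (This is the method of Marks.)

  Borel determinacy is proved by Martin's unraveling: each Borel set becomes
  clopen in a suitable cover of the game tree, from which winning strategies
  can be pushed down.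
*)

(* The constraint on labels makes each g_i act freely, so that G_i is 2-regular, and gives the
   vertices of a triangle of G_i three different i-th root coordinates while leaving the other
   coordinates unrelated; hence the three labels found by diagonalization can sit on one triangle.
   The root label is fixed in each game because the games for different i are glued at the root.
   Determinacy is needed for trees with arbitrary sets of moves, since unraveling adds sets of
   positions as moves. The obstacle is countable unions, for which infinitely many coverings have to
   be composed. A k-covering changes nothing up to level k, so if the n-th one is a (k+n)-covering,
   every level stabilizes and an inverse limit exists. There all members of the union are clopen,
   the union is open, and one more unraveling suffices. *)
Require Import Defs.
From Stdlib Require Import Eqdep_dec PeanoNat.
From HB Require Import structures.
From mathcomp Require Import all_boot all_order all_algebra.
From mathcomp Require Import all_classical all_reals all_analysis.

Set Implicit Arguments.
Unset Strict Implicit.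
Unset Printing Implicit Defensive.

Import Order.TTheory GRing.Theory Num.Theory.
Local Open Scope classical_set_scope.

(** * Game trees and quasi-strategies *)

(* The player with parity [b] moves at the positions whose level has parity
   [b]. The elements of [pos] outside [nd] are junk, and [par] is junk at
   level 0; a tree may have several positions of level 0. *)
Record tree := Tree {
  pos :> Type;
  nd : pos -> Prop;
  lev : pos -> nat;
  par : pos -> pos;
  lev_par : forall p, lev (par p) = (lev p).-1;
  nd_par : forall p, nd p -> nd (par p);
  nd_ext : forall p, nd p -> exists q, [/\ nd q, par q = p & lev q = (lev p).+1]
}.

Arguments nd {t} p.
Arguments lev {t} p.
Arguments par {t} p.

Section Tree.
Variable T : tree.
Implicit Types (p q r : T) (A S : T -> Prop) (x : nat -> T) (b : bool).

Definition child p q := [/\ nd q, par q = p & lev q = (lev p).+1].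

Definition play x := forall n, [/\ nd (x n), lev (x n) = n & par (x n.+1) = x n].

Definition serves b S p :=
  if odd (lev p) == b then exists2 q, child p q & S q
  else forall q, child p q -> S q.

(* A quasi-strategy of [b] is a set of positions, allowing [b] at least one move
   and the opponent all moves. It need not be closed under predecessors: the
   unreachable positions are harmless, and a quasi-strategy restricted to the
   levels up to [n] extends by all positions of higher level. *)
Definition qstrat b S :=
  (forall p, nd p -> lev p = 0 -> S p) /\
  (forall p, nd p -> S p -> serves b S p).

Definition desc p q := lev p <= lev q /\ iter (lev q - lev p) par q = p.

Lemma lev_iter m p : lev (iter m par p) = lev p - m.
Proof. by elim: m => [|m IH] /=; rewrite ?subn0 // lev_par IH subnS. Qed.

Lemma nd_iter m p : nd p -> nd (iter m par p).
Proof. by move=> np; elim: m => //= m; exact: nd_par. Qed.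

Lemma desc_refl p : desc p p.
Proof. by split; rewrite ?subnn. Qed.

Lemma child_desc r p q : desc r p -> child p q -> desc r q.
Proof.
move=> [le_rp e] [_ pq lq]; split; first by rewrite lq ltnW.
by rewrite lq subSn // iterSr pq.
Qed.

Lemma descP p q : desc p q <-> exists m, p = iter m par q /\ lev p + m = lev q.
Proof.
split=> [[h e]|[m [-> h]]]; first by exists (lev q - lev p); rewrite e subnKC.
by split; rewrite -h ?leq_addr // addKn.
Qed.

Lemma desc_trans p q r : desc p q -> desc q r -> desc p r.
Proof.
move=> /descP[m [-> hm]] /descP[n [e hn]]; apply/descP; exists (m + n).
by rewrite e iterD -hn -hm addnA e.
Qed.

Lemma desc_total p q r : desc p r -> desc q r -> lev p <= lev q -> desc p q.
Proof.
move=> /descP[m [ep hm]] /descP[n [eq hn]] le; apply/descP.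
have nm : n <= m by rewrite -(leq_add2l (lev p)) hm -hn leq_add2r.
exists (m - n); split; first by rewrite ep eq -iterD subnK.
by rewrite addnBA // hm -hn addnK.
Qed.

Lemma desc_eq p q : desc p q -> lev p = lev q -> p = q.
Proof. by move=> [_ e] h; move: e; rewrite h subnn. Qed.

Lemma desc_child p q : nd q -> desc p q -> p <> q ->
  exists2 r, child p r & desc r q.
Proof.
move=> nq /descP[[|m] [e h]] ne; first by case: ne; rewrite e.
have l : lev (iter m par q) = (lev p).+1.
  by rewrite lev_iter -h addnS -addSn addnK.
exists (iter m par q).
  by split=> //; exact: nd_iter.
by apply/descP; exists m; rewrite l addSnnS.
Qed.

Lemma child_uniq p q q' r : child p q -> child p q' -> desc q r -> desc q' r -> q = q'.
Proof.
move=> [_ _ l] [_ _ l'] d d'; apply: desc_eq; last by rewrite l l'.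
by apply: desc_total d d' _; rewrite l l'.
Qed.

Lemma child_nd p q : child p q -> nd p.
Proof. by case=> nq <- _; exact: nd_par. Qed.

Lemma play_child x n : play x -> child (x n) (x n.+1).
Proof. by move=> px; have [_ ln e] := px n; have [nn l _] := px n.+1; split; rewrite ?l ?ln. Qed.

Lemma play_nd x n : play x -> nd (x n).
Proof. by move=> /(_ n)[]. Qed.

Lemma play_lev x n : play x -> lev (x n) = n.
Proof. by move=> /(_ n)[]. Qed.

Lemma play_desc x m n : play x -> m <= n -> desc (x m) (x n).
Proof.
move=> px /subnK <-; elim: (n - m) => [|d IH]; first exact: desc_refl.
exact: child_desc IH (play_child _ px).
Qed.

Lemma serves_sub b S S' p :
  (forall q, child p q -> S q -> S' q) -> serves b S p -> serves b S' p.
Proof.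
rewrite /serves => h; case: ifP => _; last by move=> s q pq; apply: h => //; exact: s.
by move=> [q pq Sq]; exists q => //; exact: h.
Qed.

(* [b] can reach [S] while all moves stay in [A]. *)
Inductive force b A S : T -> Prop :=
| force_hit p : S p -> force b A S p
| force_own p q : odd (lev p) = b -> child p q -> A q -> force b A S q ->
    force b A S p
| force_opp p : odd (lev p) <> b ->
    (forall q, child p q -> A q -> force b A S q) -> force b A S p.

(* [Y] records a strategy of [b] for reaching [S] from [p]; it replaces a rank
   function on [force]. *)
Definition drives b S p (Y : T -> Prop) :=
  [/\ Y p, forall q, Y q -> desc p q,
      forall q, nd q -> Y q -> ~ S q -> serves b Y q &
      forall x n, play x -> x n = p -> (forall m, n <= m -> Y (x m)) ->
        exists2 m, n <= m & S (x m)].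

(** [force] only considers moves inside [A], so [A] has to absorb the opponent's moves for [Y] to
    meet all of them. At an opponent's node the sets of all children are united; a play stays in
    just one of them, since different children share no descendants. *)
Lemma force_drives b A S p :
  (forall p q, A p -> odd (lev p) <> b -> child p q -> A q) ->
  A p -> force b A S p -> exists Y, drives b S p Y /\ (forall q, Y q -> A q).
Proof.
move=> HA Ap fp; elim: fp Ap => {p} [p Sp|p q op pq Aq fq IH|p op fq IH] Ap.
- exists (eq p); split; last by move=> q <-.
  split=> //; first by move=> q <-; exact: desc_refl.
    by move=> q _ <-.
  by move=> x n _ e _; exists n; rewrite ?e.
- have [Y [[Yq Yd Ys Yx] YA]] := IH Aq.
  exists (fun r => r = p \/ Y r); split; last by move=> r [->|/YA].
  split.
  + by left.
  + by move=> r [->|/Yd d]; [exact: desc_refl|exact: desc_trans (child_desc (desc_refl _) pq) d].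
  + move=> r nr [-> _|Yr nS]; last by apply: serves_sub (Ys r nr Yr nS) => *; right.
    by rewrite /serves op eqxx; exists q => //; right.
  + move=> x n px e Yxm.
    have Yx' m : n < m -> Y (x m).
      move=> nm; case: (Yxm m (ltnW nm)) => // e'.
      by move: nm; rewrite -{1}(play_lev n px) e -e' (play_lev m px) ltnn.
    have eq1 : x n.+1 = q.
      apply/esym/desc_eq; first exact/Yd/Yx'.
      by case: pq => _ _ ->; rewrite -e !play_lev.
    have [m nm Sm] := Yx x n.+1 px eq1 Yx'.
    by exists m => //; exact: ltnW.
- have /choice[Y HY] : forall q, exists Y, child p q ->
      drives b S q Y /\ (forall r, Y r -> A r).
    move=> q; have [pq|npq] := pselect (child p q); last by exists (fun _ => False).
    have Aq : A q := HA _ _ Ap op pq.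
    by have [Y h] := IH q pq Aq Aq; exists Y.
  exists (fun r => r = p \/ exists2 q, child p q & Y q r); split; last first.
    by move=> r [->//|[q pq]]; case: (HY q pq) => _; apply.
  split.
  + by left.
  + move=> r [->|[q pq Yr]]; first exact: desc_refl.
    case: (HY q pq) => -[_ Yd _ _] _.
    exact: desc_trans (child_desc (desc_refl _) pq) (Yd r Yr).
  + move=> r nr [-> _|[q pq Yr] nS].
      rewrite /serves ifF; last by apply/eqP.
      by move=> q pq; right; exists q => //; case: (HY q pq) => -[].
    case: (HY q pq) => -[_ _ Ys _] _.
    by apply: serves_sub (Ys r nr Yr nS) => s _ Ysq; right; exists q.
  + move=> x n px e Yxm.
    have pc : child p (x n.+1) by rewrite -e; exact: play_child.
    have Yx' m : n < m -> Y (x n.+1) (x m).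
      move=> nm; case: (Yxm m (ltnW nm)) => [e'|[q pq Yq]].
        by move: nm; rewrite -{1}(play_lev n px) e -e' (play_lev m px) ltnn.
      suff <- : q = x n.+1 by [].
      apply: (child_uniq pq pc (r := x m)); last exact: play_desc.
      by case: (HY q pq) => -[_ + _ _] _; apply.
    case: (HY _ pc) => -[_ _ _ Yx] _.
    have [m nm Sm] := Yx x n.+1 px erefl Yx'.
    by exists m => //; exact: ltnW.
Qed.

End Tree.

(** * Switching between strategies *)

(* A player follows [M] until [F] is entered, then drives the play from that
   position [r] with [Y r] until [S] is hit at some [u], and follows [N u] from
   there on. The status is a function of the history, so that the strategy
   depends at each level only on the data of the levels below. *)
Inductive status (E : Type) := Main | Forced of E | Done of E.
Arguments Main {E}.

Section Switch.
Variables (T : tree) (b : bool) (j : nat).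
Variables (M F S : T -> Prop) (N Y : T -> T -> Prop).

Definition advance (s : status T) (p : T) : status T :=
  match s with
  | Done u => Done u
  | _ => if `[< S p >] then Done p else
         match s with
         | Forced r => Forced r
         | _ => if `[< F p >] then Forced p else Main
         end
  end.

Fixpoint status_at d p :=
  advance (if d is d'.+1 then status_at d' (par p) else Main) p.

Definition status_of p := status_at (lev p - j) p.

Definition switch p :=
  match status_of p with Main => M p | Forced r => Y r p | Done u => N u p end.

Lemma status_child p q : j <= lev p -> child p q ->
  status_of q = advance (status_of p) q.
Proof. by move=> jp [_ pq lq]; rewrite /status_of lq subSn //= pq. Qed.

Lemma status_inv p : nd p -> j <= lev p ->
  match status_of p with
  | Main => ~ S p /\ ~ F p
  | Forced r => [/\ nd r, F r & ~ S p]
  | Done u => [/\ nd u, S u, lev u <= lev p & j <= lev u]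
  end.
Proof.
rewrite /status_of => np /subnKC; move: (lev p - j) => d; elim: d p np => [|d IH] p np /=.
  rewrite addn0 => e; case: asboolP => Sp /=; first by rewrite e.
  by case: asboolP.
move=> e; have e' : j + d = lev (par p) by rewrite lev_par -e addnS.
have := IH _ (nd_par np) e'; case: (status_at d _) => [|r|u] /=.
- case: asboolP => Sp; last by case: asboolP.
  by rewrite -e leq_addr.
- by case: asboolP => Sp -[] // *; rewrite -e leq_addr.
- by move=> [nu Su lu ju]; split=> //; apply: leq_trans lu _; rewrite lev_par leq_pred.
Qed.

Hypothesis HM : forall p, nd p -> j <= lev p -> M p -> ~ F p ->
  serves b (fun q => M q \/ F q) p.
Hypothesis HY : forall r, nd r -> F r -> drives b S r (Y r).
Hypothesis HSN : forall u, nd u -> S u -> N u u.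
Hypothesis HN : forall u p, nd u -> S u -> nd p -> lev u <= lev p -> N u p ->
  serves b (N u) p.

Lemma switch_start p : nd p -> lev p = j -> M p \/ F p -> switch p.
Proof.
move=> np e; rewrite /switch /status_of e subnn /=.
case: asboolP => Sp; first by move=> _; exact: HSN.
by case: asboolP => [Fp _|nF []//]; case: (HY np Fp).
Qed.

Lemma switch_serves p : nd p -> j <= lev p -> switch p -> serves b switch p.
Proof.
move=> np jp; have := status_inv np jp.
rewrite /(switch p); case e : (status_of p) => [|r|u].
- move=> [_ nF] Mp; apply: serves_sub (HM np jp Mp nF) => q pq h.
  have nq : nd q by case: pq.
  rewrite /switch (status_child jp pq) e /=.
  case: asboolP => Sq; first exact: HSN.
  by case: asboolP => Fq; [case: (HY nq Fq)|case: h].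
- move=> [nr Fr nS] Yp; case: (HY nr Fr) => _ _ + _ => /(_ p np Yp nS).
  apply: serves_sub => q pq Yq; have nq : nd q by case: pq.
  rewrite /switch (status_child jp pq) e /=.
  by case: asboolP => Sq //; exact: HSN.
- move=> [nu Su up ju] Np; apply: serves_sub (HN nu Su np up Np) => q pq Nq.
  by rewrite /switch (status_child jp pq) e.
Qed.

(** [Done] is final, and [Forced] cannot last because a play staying in [Y r] hits [S]. *)
Lemma switch_play x : play x -> (forall n, j <= n -> switch (x n)) ->
  (forall n, j <= n -> M (x n)) \/
  exists n, [/\ j <= n, S (x n) & forall m, n <= m -> N (x n) (x m)].
Proof.
move=> px sx.
have step n : j <= n -> status_of (x n.+1) = advance (status_of (x n)) (x n.+1).
  by move=> jn; apply: status_child (play_child _ px); rewrite play_lev.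
have inv n : j <= n -> _ := fun jn => @status_inv (x n) (play_nd n px)
  (eq_ind_r (fun l => j <= l) jn (play_lev n px)).
have done_stay u n m : j <= n -> status_of (x n) = Done u -> n <= m ->
    status_of (x m) = Done u.
  move=> jn e /subnK <-; elim: (m - n) => //= d IH.
  by rewrite step ?IH // (leq_trans jn) // leq_addl.
(* The position stored in a status is the one where the play entered that status. *)
have entry d : match status_of (x (j + d)) with
    | Main => True
    | Forced r => exists n, [/\ j <= n, status_of (x n) = Forced r & x n = r]
    | Done u => exists n, [/\ j <= n, status_of (x n) = Done u & x n = u]
    end.
  elim: d => [|d IH].
    have e0 : status_of (x (j + 0)) = advance Main (x (j + 0)).
      by rewrite /status_of play_lev // addKn.
    rewrite e0; case e : (advance _ _) => [|r|u] //; rewrite -e0 in e;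
      exists (j + 0); split; rewrite ?leq_addr //; move: e; rewrite e0 /=;
      case: asboolP => _; try (by case); case: asboolP => _ //; by case.
  have jd : j <= j + d by rewrite leq_addr.
  rewrite addnS; have e1 := step _ jd.
  case e : (status_of (x (j + d).+1)) => [|r|u] //; move: e (e);
    rewrite {1}e1; case: (status_of (x (j + d))) IH => [|r'|u'] /=.
  - by move=> _; case: asboolP => // _; case: asboolP => // _ [<-] ?;
      exists (j + d).+1; rewrite leqW.
  - by move=> IH; case: asboolP => // _ [<-].
  - by [].
  - by move=> _; case: asboolP => // _; [case=> <- ?; exists (j + d).+1; rewrite leqW|case: asboolP].
  - by move=> _; case: asboolP => // _ [<-] ?; exists (j + d).+1; rewrite leqW.
  - by move=> IH [<-].
have [[n [u [jn e]]]|nodone] := pselect (exists n u, j <= n /\ status_of (x n) = Done u).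
  right; have := entry (n - j); rewrite subnKC // e => -[n0 [jn0 e0 xE]].
  have := inv n0 jn0; rewrite e0 => -[_ Su _ _].
  exists n0; split; rewrite ?xE // => m nm.
  by have := sx m (leq_trans jn0 nm); rewrite /switch (done_stay _ _ _ jn0 e0 nm).
have [[n [r [jn e]]]|noforced] := pselect (exists n r, j <= n /\ status_of (x n) = Forced r).
  exfalso; have := entry (n - j); rewrite subnKC // e => -[n0 [jn0 e0 xE]].
  have := inv n0 jn0; rewrite e0 => -[nr Fr _].
  have stay m : n0 <= m -> status_of (x m) = Forced r.
    move=> /subnK <-; elim: (m - n0) => // d IH.
    have jd : j <= d + n0 by rewrite (leq_trans jn0) // leq_addl.
    have := step _ jd; rewrite IH /=; case: asboolP => // _ e'.
    by case: nodone; exists (d + n0).+1, (x (d + n0).+1); split=> //; exact: leqW.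
  case: (HY nr Fr) => _ _ _ /(_ x n0 px xE)[m nm|m nm Sm].
    by have := sx m (leq_trans jn0 nm); rewrite /switch stay.
  by have := inv m (leq_trans jn0 nm); rewrite stay // => -[].
left=> n jn; have := sx n jn; rewrite /switch; case e : (status_of (x n)) => [|r|u] //.
  by case: noforced; exists n, r.
by case: nodone; exists n, u.
Qed.

End Switch.

(** * Coverings *)

Section Covers.
Variables (k : nat) (T' T : tree) (f : T' -> T).

Definition tree_morph :=
  forall p, nd p -> [/\ nd (f p), lev (f p) = lev p & 0 < lev p -> f (par p) = par (f p)].

(* The first clause (locality) is what allows coverings to be composed
   infinitely often, see [lift1] below. *)
Definition lifting b (phi : (T' -> Prop) -> T -> Prop) :=
  [/\ forall n S S', (forall p, nd p -> lev p <= n -> (S p <-> S' p)) ->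
        forall p, nd p -> lev p <= n -> (phi S p <-> phi S' p),
      forall S, qstrat b S -> qstrat b (phi S),
      forall S, qstrat b S -> forall p, nd p -> lev p <= k -> (phi S (f p) <-> S p) &
      forall S, qstrat b S -> forall x, play x -> (forall n, phi S (x n)) ->
        exists y, [/\ play y, forall n, S (y n) & forall n, f (y n) = x n]].

Definition covers :=
  [/\ tree_morph,
      forall p q, nd p -> nd q -> lev p <= k -> f p = f q -> p = q,
      forall p, nd p -> lev p <= k -> exists2 p', nd p' & f p' = p &
      forall b, exists phi, lifting b phi].

Lemma morph_play x : tree_morph -> play x -> play (f \o x).
Proof.
move=> fm px n; have [n0 l0 _] := px n; have [n1 l1 e1] := px n.+1.
have [f0 fl0 _] := fm _ n0; have [f1 fl1 e] := fm _ n1; split=> /=; rewrite ?fl0 //.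
by rewrite -e ?l1 //; have [_ _ ->] := px n.
Qed.

End Covers.

Lemma morph_comp (T3 T2 T1 : tree) (g : T3 -> T2) (f : T2 -> T1) :
  tree_morph g -> tree_morph f -> tree_morph (f \o g).
Proof.
move=> gm fm p np /=; have [ng lg pg] := gm p np; have [nf lf pf] := fm _ ng.
by split=> //; rewrite ?lf // => l0; rewrite pg // pf // lg.
Qed.

Lemma covers_comp k (T3 T2 T1 : tree) (g : T3 -> T2) (f : T2 -> T1) :
  covers k g -> covers k f -> covers k (f \o g).
Proof.
move=> [gm gi gs gl] [fm fi fs fl]; split.
- exact: morph_comp.
- move=> p q np nq lp e; apply: gi => //; have [np' lp' _] := gm p np.
  have [nq' lq' _] := gm q nq; by apply: fi => //; rewrite lp'.
- move=> p np lp; have [p' np' e] := fs p np lp; have [_ lp' _] := fm p' np'.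
  have [|p'' np'' e''] := gs p' np'; first by rewrite -lp' e.
  by exists p'' => //=; rewrite e''.
- move=> b; have [phi [l1 q1 a1 x1]] := gl b; have [psi [l2 q2 a2 x2]] := fl b.
  exists (psi \o phi); split.
  + by move=> n S S' h p np lp; apply: (l2 n) => // p' ? ?; apply: (l1 n).
  + by move=> S /q1/q2.
  + move=> S qS p np lp /=; have [ng lg _] := gm p np.
    by rewrite -(a1 S qS p np lp); apply: a2; rewrite ?lg //; exact: q1.
  + move=> S qS x px sx; have [y [py sy ey]] := x2 _ (q1 _ qS) x px sx.
    have [z [pz sz ez]] := x1 _ qS y py sy; exists z; split=> // n /=.
    by rewrite ez ey.
Qed.

(** * Unraveling an open set *)

Section Unravel.
Variables (T : tree) (k : nat) (U : T -> Prop).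
Implicit Types (Sg : T -> Prop) (w : option T) (p q u : T).

Let bI := odd k.

(* Martin's auxiliary game for the open set defined by [U]. The player [bI]
   moving at level [k] also chooses a quasi-strategy [Sg] for himself; at the
   next move the opponent either names a position [u] of [U] allowed by [Sg],
   through which the play then has to pass ([Some u]), or claims that the play
   stays in [Sg] without ever reaching [U] ([None]), in which case it is kept
   at positions from which [bI] cannot reach [U] within [Sg]. *)
Definition aim Sg u := [/\ U u, k.+1 < lev u & Sg u].
Definition lose Sg := force bI Sg (aim Sg).
Definition confined Sg := forall p, nd p -> Sg p -> serves bI Sg p.

Definition legal Sg w p :=
  [/\ k < lev p -> confined Sg, lev p = k.+1 -> Sg p &
      k.+1 < lev p ->
      match w with
      | None => Sg p /\ ~ lose Sg p
      | Some u => [/\ aim Sg u, nd u & lev p <= lev u -> desc p u]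
      end].

(** Beyond the level of a named [u], [legal] no longer mentions the path; that it went through [u]
    comes from the legality of the ancestor at that level. *)
Definition good Sg w p := nd p /\ forall m, legal Sg w (iter m par p).

(* The extra moves are recorded in all later positions. *)
Definition upos := (T * option (T -> Prop) * option (option T))%type.

Definition annot Sg w p : upos :=
  (p, if k < lev p then Some Sg else None, if k.+1 < lev p then Some w else None).

Definition unode (t : upos) := exists Sg w p, t = annot Sg w p /\ good Sg w p.
Definition ulev (t : upos) := lev t.1.1.
Definition upar (t : upos) : upos :=
  (par t.1.1, if k < (lev t.1.1).-1 then t.1.2 else None,
   if k.+1 < (lev t.1.1).-1 then t.2 else None).

Lemma good_par Sg w p : good Sg w p -> good Sg w (par p).
Proof. by move=> [np h]; split=> [|m]; [exact: nd_par|rewrite -iterSr]. Qed.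

Lemma good_nd Sg w p : good Sg w p -> nd p. Proof. by case. Qed.

Lemma good_legal Sg w p : good Sg w p -> legal Sg w p.
Proof. by case=> _ /(_ 0). Qed.

Lemma good_child Sg w p q : child p q -> good Sg w p -> legal Sg w q -> good Sg w q.
Proof.
by move=> [nq pq _] [_ h] lq; split=> // -[|m]; rewrite ?iterSr ?pq.
Qed.

Lemma annot_inj Sg w p Sg' w' p' : annot Sg w p = annot Sg' w' p' ->
  [/\ p = p', k < lev p -> Sg = Sg' & k.+1 < lev p -> w = w'].
Proof.
case=> <-; case: ifP => // _; last by case: ifP => [_ _ [->]|].
by move=> [->]; case: ifP => // _ [->].
Qed.

(** Only recorded data matter; in particular [w] may be replaced at level [k.+1], where it is not
    yet recorded. *)
Lemma good_annot Sg w p Sg' w' p' : annot Sg w p = annot Sg' w' p' ->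
  good Sg w p -> good Sg' w' p'.
Proof.
move=> /annot_inj[<- e1 e2] [np h]; split=> // m; case: (h m) => h1 h2 h3.
have lm : lev (iter m par p) <= lev p by rewrite lev_iter leq_subr.
split.
- by move=> l; rewrite -(e1 (leq_trans l lm)); exact: h1.
- by move=> l; rewrite -e1 -?l //; exact: h2.
- by move=> l; have l' := leq_trans l lm; rewrite -(e1 (ltnW l')) -(e2 l'); exact: h3.
Qed.

Lemma unodeE Sg w p : unode (annot Sg w p) <-> good Sg w p.
Proof.
split=> [[Sg' [w' [p' [/esym e g]]]]|g]; first exact: good_annot e g.
by exists Sg, w, p.
Qed.

Lemma good_low Sg w p : nd p -> lev p <= k -> good Sg w p.
Proof.
move=> np l; split=> // m.
have lm : lev (iter m par p) <= k by rewrite (leq_trans _ l) // lev_iter leq_subr.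
by split; [rewrite ltnNge lm|move=> e; rewrite e ltnn in lm|rewrite ltnNge ltnW].
Qed.

Lemma annot_low Sg w p : lev p <= k -> annot Sg w p = (p, None, None).
Proof. by move=> l; rewrite /annot ltnNge l ltnNge ltnW. Qed.

Lemma annot_mid Sg w w' p : lev p <= k.+1 -> annot Sg w p = annot Sg w' p.
Proof. by move=> l; rewrite /annot [k.+1 < _]ltnNge l. Qed.

Lemma upar_annot Sg w p : upar (annot Sg w p) = annot Sg w (par p).
Proof.
rewrite /upar /annot /= lev_par; congr (_, _, _).
  by case: ifP => // l; rewrite ifT // (leq_trans l) ?leq_pred.
by case: ifP => // l; rewrite ifT // (leq_trans l) ?leq_pred.
Qed.

Lemma good_confined Sg w p : good Sg w p -> k < lev p -> confined Sg.
Proof. by move=> /good_legal[h _ _] /h. Qed.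

Lemma good_mem Sg p : good Sg None p -> k < lev p -> Sg p.
Proof.
move=> /good_legal[_ h1 h2]; rewrite leq_eqVlt => /orP[/eqP/esym/h1//|/h2[]//].
Qed.

Lemma good_nlose Sg p : good Sg None p -> k.+1 < lev p -> ~ lose Sg p.
Proof. by move=> /good_legal[_ _ h] /h[]. Qed.

Lemma confined_opp Sg p q : confined Sg -> odd (lev p) <> bI -> child p q -> Sg p -> Sg q.
Proof.
move=> c o pq Sp; have := c p (child_nd pq) Sp; rewrite /serves ifF; last exact/eqP.
exact.
Qed.

Lemma lose_aim Sg p : confined Sg -> nd p -> Sg p -> lose Sg p ->
  exists u, [/\ nd u, aim Sg u & desc p u].
Proof.
move=> c np Sp l; elim: l np Sp => {p} [p Ap|p q op pq Sq _ IH|p op _ IH] np Sp.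
- by exists p; split=> //; exact: desc_refl.
- have [|u [nu Au d]] := IH _ Sq; first by case: pq.
  by exists u; split=> //; exact: desc_trans (child_desc (desc_refl _) pq) d.
- have [q [nq e l]] := nd_ext np; have pq : child p q by [].
  have Sq := confined_opp c op pq Sp.
  have [u [nu Au d]] := IH q pq Sq nq Sq.
  by exists u; split=> //; exact: desc_trans (child_desc (desc_refl _) pq) d.
Qed.

Lemma legal_low Sg w p : lev p <= k -> legal Sg w p.
Proof.
by move=> l; split; [rewrite ltnNge l|move=> e; rewrite e ltnn in l|rewrite ltnNge ltnW].
Qed.

Lemma legal_some Sg u p : confined Sg -> (lev p = k.+1 -> Sg p) -> aim Sg u -> nd u ->
  (lev p <= lev u -> desc p u) -> legal Sg (Some u) p.
Proof. by split. Qed.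

(** The rules must never block a player. The critical case is [None] with every child in [Sg]
    losing. Above level [k.+1] the position itself would then be losing, which [None] excludes; at
    level [k.+1] the opponent can still name a target, which exists by [lose_aim]. *)
Lemma upos_ext t : unode t ->
  exists t', [/\ unode t', upar t' = t & ulev t' = (ulev t).+1].
Proof.
case=> Sg [w [p [-> g]]]; have np := good_nd g.
suff [Sg' [w' [q [pq e gq]]]] : exists Sg' w' q,
    [/\ child p q, annot Sg' w' p = annot Sg w p & good Sg' w' q].
  exists (annot Sg' w' q); split; first exact/unodeE.
    by rewrite upar_annot -e; case: pq => _ ->.
  by case: pq.
have [q0 [nq0 eq0 lq0]] := nd_ext np; have pq0 : child p q0 by [].
case: (ltngtP (lev p) k) => [lt|gt|eq]; last first.
- exists (fun _ => True), None, q0; split=> //; first by rewrite !annot_low ?eq.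
  apply: good_child pq0 _ _; first by apply: good_low; rewrite ?eq.
  rewrite /legal lq0 eq ltnn; split=> // _ r nr _; rewrite /serves; case: ifP => // _.
  by have [s [ns es ls]] := nd_ext nr; exists s.
- have c := good_confined g gt.
  have [w' [<- {}g w'E]] : exists w',
      [/\ annot Sg w' p = annot Sg w p, good Sg w' p & w' = None \/ k.+1 < lev p].
    have [gt'|le'] := ltnP k.+1 (lev p); first by exists w; split=> //; right.
    by exists None; split; [exact: annot_mid|apply: good_annot g; exact: annot_mid|left].
  case: w' g w'E => [u|] g w'E; last first.
    have Sp := good_mem g gt.
    have [[q [pq Sq nl]]|noq] := pselect (exists q, [/\ child p q, Sg q & ~ lose Sg q]).
      exists Sg, None, q; split=> //; apply: (good_child pq g); split=> //.
    have all_lose q : child p q -> Sg q -> lose Sg q.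
      by move=> pq Sq; apply: contrapT => nl; apply: noq; exists q.
    have lk : lev p = k.+1.
      apply/eqP; rewrite eqn_leq gt andbT leqNgt; apply/negP => gt'.
      apply: (good_nlose g gt').
      have := c p np Sp; rewrite /serves; case: ifP => [/eqP o [q pq Sq]|/eqP o].
        exact: force_own o pq Sq (all_lose _ pq Sq).
      by move=> h; apply: force_opp => // q pq Sq; apply: all_lose.
    have o : odd (lev p) <> bI by rewrite lk /= /bI; case: (odd k).
    have Sq0 := confined_opp c o pq0 Sp.
    have [u [nu Au d]] := lose_aim c nq0 Sq0 (all_lose _ pq0 Sq0).
    exists Sg, (Some u), q0; split=> //; first by apply: annot_mid; rewrite lk.
    apply: good_child pq0 _ _; last by apply: legal_some => // e; rewrite lq0 e in lk.
    by apply: good_annot g; apply: annot_mid; rewrite lk.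
  have gt' : k.+1 < lev p by case: w'E.
  have [_ _ /(_ gt')[Au nu d]] := good_legal g.
  have [lt|ge] := ltnP (lev p) (lev u); last first.
    exists Sg, (Some u), q0; split=> //; apply: good_child pq0 g _; apply: legal_some => //.
      by rewrite lq0 => -[e]; rewrite e ltnn in gt.
    by rewrite lq0 ltnNge ge.
  have [|q pq dq] := desc_child nu (d (ltnW lt)); first by move=> e; rewrite e ltnn in lt.
  exists Sg, (Some u), q; split=> //; apply: (good_child pq g); apply: legal_some => //.
  by case: pq => _ _ -> -[e]; rewrite e ltnn in gt.
- exists Sg, w, q0; split=> //; apply: good_child pq0 g _; apply: legal_low.
  by rewrite lq0.
Qed.

Lemma ulev_par t : ulev (upar t) = (ulev t).-1.
Proof. exact: lev_par. Qed.

Lemma unode_par t : unode t -> unode (upar t).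
Proof.
by case=> Sg [w [p [-> g]]]; rewrite upar_annot; apply/unodeE; exact: good_par.
Qed.

Definition utree := Tree ulev_par unode_par upos_ext.

Lemma lev_annot Sg w p : @lev utree (annot Sg w p) = lev p. Proof. by []. Qed.

Lemma child_annot Sg w p q : child p q -> good Sg w q ->
  @child utree (annot Sg w p) (annot Sg w q).
Proof.
move=> [nq e l] g; split; [exact/unodeE| |exact: l].
by rewrite [par _]upar_annot e.
Qed.

Lemma child_inv Sg w p (t : utree) : child (annot Sg w p : utree) t ->
  exists Sg' w' q, [/\ t = annot Sg' w' q, child p q, good Sg' w' q &
    annot Sg' w' p = annot Sg w p].
Proof.
case=> -[Sg' [w' [q [-> g]]]] e l; exists Sg', w', q; split=> //.
  split=> //; first exact: good_nd g.
  by have := congr1 (fun t => t.1.1) e.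
have pq : par q = p by have := congr1 (fun t => t.1.1) e.
by rewrite -e [par _]upar_annot pq.
Qed.

Lemma child_high Sg w p (t : utree) : k.+1 < lev p -> child (annot Sg w p : utree) t ->
  exists q, [/\ t = annot Sg w q, child p q & good Sg w q].
Proof.
move=> l /child_inv[Sg' [w' [q [-> pq g /esym/annot_inj[_ e1 e2]]]]].
by exists q; rewrite e1 ?e2 // ltnW.
Qed.

Lemma play_lift (s : utree -> Prop) Sg w (x : nat -> T) : play x ->
  (forall n, good Sg w (x n) /\ s (annot Sg w (x n))) ->
  exists y : nat -> utree,
    [/\ play y, forall n, s (y n) & forall n, (y n).1.1 = x n].
Proof.
move=> px h; exists (fun n => annot Sg w (x n)); split=> // [n|n]; last by case: (h n).
have [nx lx ex] := px n; split=> //; first by apply/unodeE; case: (h n).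
by rewrite [par _]upar_annot ex.
Qed.

(** On the way to a named [u] a single child is legal, so a quasi-strategy of either player contains
    the whole path. *)
Lemma aim_path b (s : utree -> Prop) Sg u p : qstrat b s -> aim Sg u -> nd u ->
  k.+1 < lev p -> good Sg (Some u) p -> s (annot Sg (Some u) p) ->
  forall q, desc p q -> desc q u -> good Sg (Some u) q /\ s (annot Sg (Some u) q).
Proof.
move=> [_ qs] Au nu kp gp sp q dpq; have [+ _] := dpq.
move=> /subnKC; move: (lev q - lev p) => m; elim: m q dpq => [|m IH] q dpq e dqu.
  by rewrite -(desc_eq dpq) // -e addn0.
have nq : nd q by case: dqu => _ <-; exact: nd_iter.
have c : child (par q) q by split=> //; rewrite lev_par -e addnS.
have dp : desc (par q) q := child_desc (desc_refl _) c.
have dpu := desc_trans dp dqu.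
have lq : lev (par q) = lev p + m by rewrite lev_par -e addnS.
have [||//|gq sq] := IH (par q).
- by apply: (desc_total dpq dp); rewrite lq leq_addr.
- by rewrite lq.
have kq : k.+1 < lev (par q) by rewrite lq (leq_trans kp) // leq_addr.
have gq' : good Sg (Some u) q.
  apply: (good_child c gq); apply: legal_some => //; first exact: good_confined gq (ltnW kq).
  by case: c => _ _ ->; move=> [e']; rewrite e' ltnNge leqW in kq.
split=> //; have : serves b s (annot Sg (Some u) (par q)) by apply: qs => //; exact/unodeE.
rewrite /serves; case: ifP => _; last by apply; exact: child_annot.
case=> t /(child_high kq)[q' [-> c' gq'' ]].
suff -> : q' = q by [].
apply: (child_uniq c' c _ dqu).
have [_ _ h] := good_legal gq''; case: c' c => [_ _ l'] [_ _ l].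
have [|_ _] := h; first by rewrite l' leqW.
by apply; rewrite l' -l; case: dqu.
Qed.

Definition anc p := iter (lev p - k.+1) par p.

Lemma anc_desc p q : k < lev p -> desc p q -> anc q = anc p.
Proof.
move=> kp /descP[m [ep e]]; rewrite /anc {2}ep -iterD; congr (iter _ _ _).
by rewrite -e addnBAC.
Qed.

Lemma desc_anc p : k < lev p -> desc (anc p) p /\ lev (anc p) = k.+1.
Proof.
move=> kp; have l : lev (anc p) = k.+1 by rewrite lev_iter subKn.
by split=> //; split; rewrite l.
Qed.

Lemma anc_id p : lev p = k.+1 -> anc p = p.
Proof. by rewrite /anc => ->; rewrite subnn. Qed.

Lemma lev_anc p : lev (anc p) = k.+1 -> k < lev p.
Proof.
move=> e; have [h|//] := leqP (lev p) k; move: e; rewrite /anc lev_iter.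
rewrite (eqP (_ : lev p - k.+1 == 0)) ?subn0 => [e|]; first by rewrite e ltnn in h.
by rewrite subn_eq0 leqW.
Qed.

(** At [anc u] the opponent of [bI] is to answer; if [s] accepts every answer, it accepts [Some u],
    and [aim_path] does the rest. *)
Lemma aim_start b (s : utree -> Prop) Sg u : qstrat b s -> aim Sg u -> nd u ->
  good Sg None (anc u) -> s (annot Sg None (anc u)) ->
  (forall t, child (annot Sg None (anc u) : utree) t -> s t) ->
  forall q, desc (anc u) q -> desc q u -> k < lev q ->
  good Sg (Some u) q /\ s (annot Sg (Some u) q).
Proof.
move=> qs Au nu g0 s0 h q d1 d2 kq.
have [U_ ku Su] := Au; have [da la] := desc_anc (ltnW ku).
have e0 : annot Sg None (anc u) = annot Sg (Some u) (anc u) by apply: annot_mid; rewrite la.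
have g0' : good Sg (Some u) (anc u) by apply: good_annot g0.
have [eq|ne] := pselect (anc u = q); first by rewrite -eq -e0.
have [|r cr dr] := desc_child _ d1 ne; first by case: d2 => _ <-; exact: nd_iter.
have lr : lev r = k.+2 by case: cr => _ _ ->; rewrite la.
have gr : good Sg (Some u) r.
  apply: (good_child cr g0'); apply: legal_some => //.
  - by apply: good_confined g0 _; rewrite la.
  - by rewrite lr => -[] e; move: (ltnn k.+1); rewrite {1}e ltnSn.
  - by move=> _; exact: desc_trans dr d2.
apply: (aim_path qs Au nu _ gr) => //; first by rewrite lr.
by apply: h; rewrite e0; exact: child_annot.
Qed.

Definition choose_or A (a0 : A) (P : A -> Prop) : A :=
  if pselect (exists a, P a) is left e then sval (cid e) else a0.

Lemma choose_orP A (a0 : A) (P : A -> Prop) : (exists a, P a) -> P (choose_or a0 P).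
Proof. by rewrite /choose_or; case: pselect => // e _; case: cid. Qed.

Lemma serves_low b (s : utree -> Prop) (phi : T -> Prop) p :
  qstrat b s -> nd p -> lev p < k -> s (p, None, None) ->
  (forall q, lev q <= k -> s (q, None, None) -> phi q) -> serves b phi p.
Proof.
move=> [_ qs] np lp sp h.
have e0 : annot (fun=> True) None p = (p, None, None) := annot_low _ _ (ltnW lp).
have : serves b s (p, None, None).
  by apply: qs => //; rewrite -e0; apply/unodeE/good_low => //; exact: ltnW.
rewrite /serves -e0 lev_annot; case: ifP => _.
  move=> -[t /child_inv[Sg [w [q [-> pq g _]]]] sq]; exists q => //.
  have lq : lev q <= k by case: pq => _ _ ->.
  by apply: h => //; rewrite -(annot_low Sg w).
move=> hc q pq; have lq : lev q <= k by case: pq => _ _ ->.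
apply: h => //; rewrite -(annot_low (fun=> True) None lq); apply: hc.
by apply: child_annot => //; apply: good_low => //; case: pq.
Qed.

(* Lifting a strategy [s] of the player [bI]. He plays the set [choice_at]
   chosen by [s] and pretends that the opponent answered [None]. Once [U] can be
   forced within this set, he forces it, and from the position [u] so reached he
   pretends that the opponent had answered [Some u]. *)
Section LiftMover.
Variable s : utree -> Prop.

Definition chosen p1 Sg := [/\ lev p1 = k.+1, good Sg None p1 & s (annot Sg None p1)].
Definition choice_at p : T -> Prop := choose_or (fun=> False) (chosen (anc p)).
Definition settled p := chosen (anc p) (choice_at p).
Definition moverM p :=
  settled p /\ (good (choice_at p) None p /\ s (annot (choice_at p) None p)).
Definition moverF p := [/\ settled p, lose (choice_at p) p & choice_at p p].
Definition moverS p := settled p /\ aim (choice_at p) p.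
Definition moverN u p := good (choice_at u) (Some u) p /\ s (annot (choice_at u) (Some u) p).
Definition moverY p : T -> Prop := choose_or (fun=> False) (drives bI moverS p).
Definition mover_sw := switch k.+1 moverM moverF moverS moverN moverY.
Definition mover_phi p := if lev p <= k then s (p, None, None) else mover_sw p.

Hypothesis qs : qstrat bI s.

Lemma settled_anc p q : k < lev p -> desc p q ->
  settled q = settled p /\ choice_at q = choice_at p.
Proof. by move=> kp d; rewrite /settled /choice_at (anc_desc kp d). Qed.

Lemma settled_lev p : settled p -> k < lev p.
Proof. by case=> l _ _; exact: lev_anc. Qed.

Lemma settled_confined p : settled p -> confined (choice_at p).
Proof. by move=> [l g _]; apply: good_confined g _; rewrite l. Qed.

Lemma mover_mid : odd k.+1 <> bI.
Proof. by rewrite /bI /=; case: (odd k). Qed.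

Lemma mover_drives p : nd p -> moverF p -> drives bI moverS p (moverY p).
Proof.
move=> np [sp lp cp]; apply: choose_orP; have kp := settled_lev sp.
have cf := settled_confined sp.
have [|Y [[Y0 Yd Ys Yx] YA]] := force_drives _ cp lp.
  by move=> r q cr o rq; exact: confined_opp cf o rq cr.
(* [moverS] recomputes the chosen set at each position, but below [p] it is always the set chosen at
   [p]. *)
have SE q : Y q -> moverS q = aim (choice_at p) q.
  move=> Yq; have [e1 e2] := settled_anc kp (Yd q Yq).
  by rewrite /moverS e1 e2; apply/propext; split=> [[]|].
exists Y; split=> // [q nq Yq nS|x n px e h].
  by apply: Ys => //; rewrite -SE.
have [m nm Sm] := Yx x n px e h.
by exists m => //; rewrite SE //; exact: h.
Qed.

Lemma moverN_path u : nd u -> moverS u -> forall q, desc (anc u) q -> desc q u ->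
  k < lev q -> moverN u q.
Proof.
move=> nu [su au] q d1 d2 kq; have [l g sg] := su.
apply: (aim_start qs au nu g sg) => //.
have : serves bI s (annot (choice_at u) None (anc u)) by apply: qs.2 => //; exact/unodeE.
rewrite /serves ifF //; apply/eqP; rewrite lev_annot l; exact: mover_mid.
Qed.

Lemma moverSN u : nd u -> moverS u -> moverN u u.
Proof.
move=> nu Su; have ku := settled_lev Su.1.
by apply: moverN_path => //; [case: (desc_anc ku)|exact: desc_refl].
Qed.

Lemma moverN_serves u p : nd u -> moverS u -> nd p -> lev u <= lev p -> moverN u p ->
  serves bI (moverN u) p.
Proof.
move=> nu [su [_ ku _]] np up [g sp]; have kp : k.+1 < lev p := leq_trans ku up.
have : serves bI s (annot (choice_at u) (Some u) p) by apply: qs.2 => //; exact/unodeE.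
rewrite /serves lev_annot; case: ifP => _.
  by case=> t /(child_high kp)[q [-> pq gq]] sq; exists q.
move=> h q pq; have gq : good (choice_at u) (Some u) q.
  apply: (good_child pq g); have [c _ /(_ kp)[Au _ _]] := good_legal g.
  have lq : lev q = (lev p).+1 by case: pq.
  apply: legal_some => //; first by apply: c; exact: ltnW.
    by rewrite lq => -[e]; rewrite e ltnNge leqnSn in kp.
  by rewrite lq ltnNge up.
by split=> //; apply: h; exact: child_annot.
Qed.

(** An opponent's move either lets [bI] force [U] within the chosen set, which triggers the switch,
    or is legal after the answer [None]. *)
Lemma moverM_serves p : nd p -> k < lev p -> moverM p -> ~ moverF p ->
  serves bI (fun q => moverM q \/ moverF q) p.
Proof.
move=> np kp [sp [g sgp]] nF.
have cE q : child p q -> settled q = settled p /\ choice_at q = choice_at p.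
  by move=> pq; apply: settled_anc => //; exact: child_desc (desc_refl _) pq.
have : serves bI s (annot (choice_at p) None p) by apply: qs.2 => //; exact/unodeE.
rewrite /serves lev_annot; case: ifP => [/eqP o|/eqP o h q pq].
  have kp' : k.+1 < lev p.
    by rewrite ltn_neqAle kp andbT; apply/eqP => e; apply: mover_mid; rewrite e.
  case=> t /(child_high kp')[q [-> pq gq]] sq; exists q => //; left.
  by case: (cE q pq) => e1 e2; rewrite /moverM e1 e2.
case: (cE q pq) => e1 e2.
have Sq := confined_opp (good_confined g kp) o pq (good_mem g kp).
have [lq|nlq] := pselect (lose (choice_at p) q).
  by right; rewrite /moverF e1 e2.
have lq : lev q = (lev p).+1 by case: pq.
left; rewrite /moverM e1 e2; split=> //.
have gq : good (choice_at p) None q.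
  by apply: (good_child pq g); split=> // _; exact: good_confined g kp.
by split=> //; apply: h; exact: child_annot.
Qed.

Lemma mover_qstrat : qstrat bI mover_phi.
Proof.
split=> [p np l0|p np].
  rewrite /mover_phi l0 /= -(annot_low (fun=> True) None (p := p)) ?l0 //.
  by apply: qs.1 => //; apply/unodeE/good_low; rewrite ?l0.
rewrite {1}/mover_phi; case: ltngtP => // [lp sp|lp sp|lp sp].
- apply: (serves_low qs np lp sp) => q lq sq; by rewrite /mover_phi lq.
- have := switch_serves moverM_serves mover_drives moverSN moverN_serves np lp sp.
  apply: serves_sub => q [_ _ lq]; rewrite /mover_phi lq leqNgt ltnW //.
- have e0 := annot_low (fun=> True) None (eq_leq lp).
  have : serves bI s (p, None, None).
    by apply: qs.2 => //; rewrite -e0; apply/unodeE/good_low; rewrite ?lp.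
  rewrite /serves -[(p, _, _)]e0 lev_annot lp eqxx.
  case=> t /child_inv[Sg [w [q [-> pq g _]]]] sq.
  have lq : lev q = k.+1 by case: pq => _ _ ->; rewrite lp.
  have cq : chosen q Sg.
    have e : annot Sg w q = annot Sg None q by apply: annot_mid; rewrite lq.
    by split; rewrite -?e //; apply: good_annot e g.
  have sq' : settled q by apply: choose_orP; exists Sg; rewrite anc_id.
  exists q => //; rewrite /mover_phi lq ltnn.
  apply: (switch_start mover_drives moverSN) => //; first by case: pq.
  by left; split=> //; case: sq'; rewrite anc_id.
Qed.

Lemma mover_lift x : play x -> (forall n, mover_phi (x n)) ->
  exists y : nat -> utree,
    [/\ play y, forall n, s (y n) & forall n, (y n).1.1 = x n].
Proof.
move=> px hx.
have low n Sg w : n <= k -> good Sg w (x n) /\ s (annot Sg w (x n)).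
  have [nx lx _] := px n; move=> nk; rewrite annot_low ?lx //.
  split; first by apply: good_low => //; rewrite lx.
  by have := hx n; rewrite /mover_phi lx nk.
have sx n : k < n -> mover_sw (x n).
  by move=> kn; have := hx n; rewrite /mover_phi play_lev // leqNgt kn.
case: (switch_play mover_drives px sx).
  move=> Mx; have [c0 _] := Mx k.+1 (leqnn _).
  apply: (play_lift (Sg := choice_at (x k.+1)) (w := None)) => // n.
  have [/low//|kn] := leqP n k; have [_ h] := Mx n kn.
  have [||_ <-//] := @settled_anc (x k.+1) (x n); first by rewrite play_lev.
  exact: play_desc.
case=> n [kn Sn Nn].
apply: (play_lift (Sg := choice_at (x n)) (w := Some (x n))) => // m.
have [/low//|km] := leqP m k; have [/Nn//|mn] := leqP n m.
have ex : anc (x n) = x k.+1.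
  rewrite -(anc_id (p := x k.+1)) ?play_lev //; apply: anc_desc; first by rewrite play_lev.
  exact: play_desc.
apply: moverN_path => //; rewrite ?ex ?play_lev //; first exact: play_nd.
  exact: play_desc.
exact: play_desc (ltnW mn).
Qed.

End LiftMover.

(** Above level [k], membership of [p] depends on the set that [s] chooses at level [k.+1] and on
    [s] at the level of [p]. *)
Lemma mover_local n (s s' : utree -> Prop) :
  (forall t, nd t -> lev t <= n -> (s t <-> s' t)) ->
  forall p, nd p -> lev p <= n -> (mover_phi s p <-> mover_phi s' p).
Proof.
move=> h p np lp; rewrite /mover_phi; case: leqP => kp.
  by apply: h => //; rewrite -(annot_low (fun=> True) None kp); apply/unodeE/good_low.
have hs Sg w q : lev q <= n ->
    (good Sg w q /\ s (annot Sg w q)) <-> (good Sg w q /\ s' (annot Sg w q)).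
  move=> lq; split=> -[g sq]; split=> //; move: sq;
  by apply h => //; exact/unodeE.
have cE : chosen s = chosen s'.
  apply/funext => q; apply/funext => Sg; apply/propext; split.
    move=> [l g sq]; have lq : lev q <= n by rewrite l (leq_trans kp).
    by have [h1 _] := hs Sg None q lq; case: h1.
  move=> [l g sq]; have lq : lev q <= n by rewrite l (leq_trans kp).
  by have [_ h1] := hs Sg None q lq; case: h1.
have chE : choice_at s = choice_at s' by rewrite /choice_at cE.
have sE : settled s = settled s' by rewrite /settled cE chE.
have FE : moverF s = moverF s' by rewrite /moverF sE chE.
have SE : moverS s = moverS s' by rewrite /moverS sE chE.
have YE : moverY s = moverY s' by rewrite /moverY SE.
rewrite /mover_sw /switch /moverM /moverN /status_of FE SE YE sE chE.
case: (status_at _ _ _ _) => [|r|u] //.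
  by split=> -[? ?]; split=> //; apply/hs.
exact: hs.
Qed.

Definition anc2 u := iter (lev u - k.+2) par u.

Lemma anc2P u : k.+1 < lev u ->
  [/\ desc (anc2 u) u, lev (anc2 u) = k.+2 & child (anc u) (anc2 u)] \/ ~ nd u.
Proof.
move=> ku; have l : lev (anc2 u) = k.+2 by rewrite lev_iter subKn.
have [nu|] := pselect (nd u); [left|by right].
split=> //; first by split; rewrite l.
split; first exact: nd_iter.
  by rewrite /anc2 /anc -iterS -subSn.
by rewrite l; have [_ ->] := desc_anc (ltnW ku).
Qed.

Lemma anc2_desc u q : lev q = k.+2 -> desc q u -> anc2 u = q.
Proof. by move=> l [_ e]; rewrite /anc2 -l. Qed.

(* Lifting a strategy [s] of the opponent of [bI]. Let [respS] be the set of
   positions [u] that [s] names in answer to some [Sg]. As long as [respS] cannot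
   be forced, [b] pretends that [bI] has played the set [avoid] of these
   positions: the answer of [s] to it must be [None]. Otherwise he forces the
   play to some [u] of [respS] and pretends that [bI] had played a set [Sg]
   answered by [u]. *)
Section LiftResponder.
Variable s : utree -> Prop.
Let b := ~~ bI.

Definition answer u Sg := good Sg (Some u) (anc2 u) /\ s (annot Sg (Some u) (anc2 u)).
Definition respS u := [/\ U u, k.+1 < lev u & exists Sg, answer u Sg].
Definition answer_at u : T -> Prop := choose_or (fun=> False) (answer u).
Definition respF := force b (fun=> True) respS.
Definition avoid p := ~ respF p.
Definition respM p := good avoid None p /\ s (annot avoid None p).
Definition respN u p := good (answer_at u) (Some u) p /\ s (annot (answer_at u) (Some u) p).
Definition respY p : T -> Prop := choose_or (fun=> False) (drives b respS p).
Definition resp_sw := switch k.+1 respM respF respS respN respY.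
(* At level [k.+1] membership is read off the predecessor, since [respF]
   depends on [s] at level [k.+2]. *)
Definition resp_phi p :=
  if lev p <= k then s (p, None, None)
  else if lev p == k.+1 then s (par p, None, None) else resp_sw p.

Hypothesis qs : qstrat b s.

Lemma resp_turn (m : bool) : m <> b -> m = bI.
Proof. by rewrite /b; case: m; case: bI. Qed.

Lemma resp_drives p : nd p -> respF p -> drives b respS p (respY p).
Proof.
move=> np Fp; apply: choose_orP.
by have [//|//|Y [HY _]] := force_drives _ _ Fp; exists Y.
Qed.

Lemma answer_atP u : respS u -> answer u (answer_at u).
Proof. by case=> _ _ h; apply: choose_orP. Qed.

Lemma answer_aim u Sg : k.+1 < lev u -> nd u -> answer u Sg -> aim Sg u.
Proof.
move=> ku nu [g _]; have [[_ l _]|//] := anc2P ku.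
by have [_ _ h] := good_legal g; case: h; rewrite ?l.
Qed.

Lemma respN_path u : nd u -> respS u -> forall q, desc (anc2 u) q -> desc q u ->
  respN u q.
Proof.
move=> nu Su q d1 d2; have [_ ku _] := Su; have [[_ l _]|//] := anc2P ku.
have [g sg] := answer_atP Su.
by apply: (aim_path qs (answer_aim ku nu (answer_atP Su)) nu _ g sg); rewrite ?l.
Qed.

Lemma respSN u : nd u -> respS u -> respN u u.
Proof.
move=> nu Su; have [_ ku _] := Su; have [[d _ _]|//] := anc2P ku.
by apply: respN_path => //; exact: desc_refl.
Qed.

Lemma respN_serves u p : nd u -> respS u -> nd p -> lev u <= lev p -> respN u p ->
  serves b (respN u) p.
Proof.
move=> nu [_ ku _] np up [g sp]; have kp : k.+1 < lev p := leq_trans ku up.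
have : serves b s (annot (answer_at u) (Some u) p) by apply: qs.2 => //; exact/unodeE.
rewrite /serves lev_annot; case: ifP => _.
  by case=> t /(child_high kp)[q [-> pq gq]] sq; exists q.
move=> h q pq; have gq : good (answer_at u) (Some u) q.
  apply: (good_child pq g); have [c _ /(_ kp)[Au _ _]] := good_legal g.
  have lq : lev q = (lev p).+1 by case: pq.
  apply: legal_some => //; first by apply: c; exact: ltnW.
    by rewrite lq => -[e]; rewrite e ltnNge leqnSn in kp.
  by rewrite lq ltnNge up.
by split=> //; apply: h; exact: child_annot.
Qed.

(** The positions from which one player cannot force form a quasi-strategy of the other one; so
    [avoid] is a set that [bI] may choose. *)
Lemma avoid_confined : confined avoid.
Proof.
move=> p np; apply: contra_notP; rewrite /serves; case: ifP => [/eqP o h|/eqP o h].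
  apply: force_opp => [|q pq _]; first by rewrite o /b; case: bI.
  by apply: contrapT => nq; apply: h; exists q.
have /existsNP[q /not_implyP[pq /contrapT Fq]] := h.
by apply: (force_own _ pq) => //; move: o; rewrite /b; case: bI; case: odd.
Qed.

Lemma respM_serves p : nd p -> k < lev p -> respM p -> ~ respF p ->
  serves b (fun q => respM q \/ respF q) p.
Proof.
move=> np kp [g sgp] nF.
have : serves b s (annot avoid None p) by apply: qs.2 => //; exact/unodeE.
rewrite /serves lev_annot; case: ifP => [/eqP o|/eqP o h q pq].
  case=> t /child_inv[Sg [w [q [-> pq gq /esym/annot_inj[_ e1 e2]]]]] sq.
  exists q => //; left; rewrite -e1 // in gq sq.
  (* An answer [Some u] to [avoid] would put [u] into [respS], whereas its legality puts [u] into
     [avoid]. *)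
  case: w e2 gq sq => // u e2 gq sq; exfalso.
  have lp : lev p = k.+1.
    by apply/eqP; rewrite eqn_leq kp andbT leqNgt; apply/negP => /e2.
  have lq : lev q = k.+2 by case: pq => _ _ ->; rewrite lp.
  have [_ _] := good_legal gq; rewrite lq => /(_ (ltnSn _))[Au nu du].
  have [Uu ku avu] := Au; apply: avu; apply: force_hit; split=> //; exists avoid.
  by rewrite /answer (anc2_desc lq (du ku)).
have kp' : k.+1 < lev p.
  rewrite ltn_neqAle kp andbT; apply/eqP => e; apply: o.
  by rewrite -e /b /bI.
have [Fq|nFq] := pselect (respF q); [by right|left].
have lq : lev q = (lev p).+1 by case: pq.
have gq : good avoid None q.
  apply: (good_child pq g); split=> // _; [exact: avoid_confined|].
  (* If [q] were losing, the move of [bI] to [q] would make [p] losing too. *)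
  split=> // lose_q; apply: (good_nlose g kp').
  exact: (force_own (resp_turn o) pq nFq lose_q).
by split=> //; apply: h; exact: child_annot.
Qed.

Lemma resp_start p : nd p -> lev p = k.+1 -> s (par p, None, None) -> resp_sw p.
Proof.
move=> np lp sp; apply: (switch_start resp_drives respSN) => //.
have [Fp|nFp] := pselect (respF p); [by right|left].
have lpp : lev (par p) = k by rewrite lev_par lp.
have cp : child (par p) p by split; rewrite ?lpp.
have e0 := annot_low avoid None (eq_leq lpp).
have g0 : good avoid None (par p) by apply: good_low; rewrite ?lpp //; exact: nd_par.
have gp : good avoid None p.
  by apply: (good_child cp g0); split=> // [_|]; [exact: avoid_confined|rewrite lp ltnn].
split=> //.
have : serves b s (par p, None, None) by apply: qs.2 => //; rewrite -e0; exact/unodeE.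
rewrite /serves -[(par p, _, _)]e0 lev_annot lpp ifF; last by rewrite /b /bI; case: odd.
by apply; exact: child_annot.
Qed.

Lemma resp_qstrat : qstrat b resp_phi.
Proof.
split=> [p np l0|p np].
  rewrite /resp_phi l0 /= -(annot_low (fun=> True) None (p := p)) ?l0 //.
  by apply: qs.1 => //; apply/unodeE/good_low; rewrite ?l0.
have hi : k < lev p -> resp_sw p -> serves b resp_phi p.
  move=> lp sp.
  have := switch_serves respM_serves resp_drives respSN respN_serves np lp sp.
  apply: serves_sub => q [_ _ lq].
  by rewrite /resp_phi lq leqNgt ltnW //= eqSS gtn_eqF.
rewrite {1}/resp_phi; case: ltngtP => // [lp sp|lp|lp sp].
- apply: (serves_low qs np lp sp) => q lq sq; by rewrite /resp_phi lq.
- case: eqP => [e sp|_ sp]; apply: hi => //; exact: resp_start.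
- rewrite /serves lp ifF; last by rewrite /b /bI; case: odd.
  move=> q [_ pq lq]; rewrite /resp_phi lq lp ltnn eqxx.
  by rewrite pq.
Qed.

Lemma resp_lift x : play x -> (forall n, resp_phi (x n)) ->
  exists y : nat -> utree,
    [/\ play y, forall n, s (y n) & forall n, (y n).1.1 = x n].
Proof.
move=> px hx.
have low n Sg w : n <= k -> good Sg w (x n) /\ s (annot Sg w (x n)).
  have [nx lx _] := px n; move=> nk; rewrite annot_low ?lx //.
  split; first by apply: good_low => //; rewrite lx.
  by have := hx n; rewrite /resp_phi lx nk.
have sx n : k < n -> resp_sw (x n).
  move=> kn; have := hx n; rewrite /resp_phi play_lev // leqNgt kn.
  case: eqP => // -> sk; apply: resp_start => //; [exact: play_nd|exact: play_lev].
case: (switch_play resp_drives px sx).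
  move=> Mx; apply: (play_lift (Sg := avoid) (w := None)) => // n.
  by have [/low//|/Mx] := leqP n k.
case=> n [kn Sn Nn]; have nx := play_nd n px.
have [_ ku _] := Sn; have [[da la ca]|//] := anc2P ku.
have [ga sa] := answer_atP Sn.
have ex : anc2 (x n) = x k.+2.
  apply: anc2_desc; first exact: play_lev.
  by apply: play_desc => //; rewrite play_lev in ku.
have ex1 : anc (x n) = x k.+1.
  rewrite -(anc_id (p := x k.+1)) ?play_lev //; apply: anc_desc; first by rewrite play_lev.
  exact: play_desc.
apply: (play_lift (Sg := answer_at (x n)) (w := Some (x n))) => // m.
have [/low//|km] := leqP m k; have [/Nn//|mn] := leqP n m.
have [km'|le] := ltnP k.+1 m.
  by apply: respN_path => //; rewrite ?ex; apply: play_desc => //; exact: ltnW.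
(* [respN_path] only starts at level [k.+2]. Level [k.+1] is reached by a move of [bI], so [s]
   accepts it together with any legal set. *)
have -> : m = k.+1 by apply/eqP; rewrite eqn_leq km le.
have g1 : good (answer_at (x n)) (Some (x n)) (x k.+1).
  by have := good_par ga; case: ca => _ -> _; rewrite ex1.
split=> //; have e0 := annot_low (answer_at (x n)) (Some (x n)) (p := x k).
have : serves b s (x k, None, None).
  rewrite -e0 ?play_lev //; apply: qs.2; last by case: (low k (answer_at (x n)) (Some (x n))).
  by apply/unodeE; case: (low k (answer_at (x n)) (Some (x n))).
rewrite /serves -[(x k, _, _)]e0 ?play_lev // lev_annot play_lev // ifF; last by rewrite /b /bI; case: odd.
by apply; apply: child_annot => //; exact: play_child.
Qed.

End LiftResponder.

(** The sets [respS] and [respF] are read off [s] at level [k.+2], which is available as soon as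
    [resp_sw] is used. *)
Lemma resp_local n (s s' : utree -> Prop) :
  (forall t, nd t -> lev t <= n -> (s t <-> s' t)) ->
  forall p, nd p -> lev p <= n -> (resp_phi s p <-> resp_phi s' p).
Proof.
move=> h p np lp; rewrite /resp_phi; case: leqP => kp.
  by apply: h => //; rewrite -(annot_low (fun=> True) None kp); apply/unodeE/good_low.
case: eqP => [e|/eqP ne].
  have l : lev (par p) <= k by rewrite lev_par e.
  rewrite -(annot_low (fun=> True) None l); apply: h.
    by apply/unodeE/good_low => //; exact: nd_par.
  by rewrite lev_annot (leq_trans _ lp) // lev_par leq_pred.
have {ne}kp : k.+1 < lev p by rewrite ltn_neqAle eq_sym ne kp.
have hs Sg w q : lev q <= n ->
    (good Sg w q /\ s (annot Sg w q)) <-> (good Sg w q /\ s' (annot Sg w q)).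
  move=> lq; split=> -[g sq]; split=> //; move: sq;
  by apply h => //; exact/unodeE.
have aE u : k.+1 < lev u -> answer s u = answer s' u.
  move=> ku; apply/funext => Sg; apply/propext; apply: hs.
  by rewrite lev_iter subKn // (leq_trans kp).
have SE : respS s = respS s'.
  by apply/funext => u; apply/propext; split=> -[? ku ?]; split; rewrite ?aE // -?aE.
have FE : respF s = respF s' by rewrite /respF SE.
have YE : respY s = respY s' by rewrite /respY SE.
have AE : avoid s = avoid s' by rewrite /avoid FE.
have := @status_inv _ k.+1 (respF s) (respS s) p np (ltnW kp).
rewrite /resp_sw /switch /respM /status_of -FE -SE -YE -AE.
case: (status_at _ _ _ _) => [|r|u] //.
  by move=> _; apply: hs.
move=> [_ [_ ku _] _ _]; rewrite /respN /answer_at aE //; exact: hs.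
Qed.

Definition uproj (t : utree) : T := t.1.1.

Lemma uproj_morph : tree_morph uproj.
Proof. by move=> t [Sg [w [p [-> g]]]]; split=> //; exact: good_nd g. Qed.

Lemma uproj_covers : covers k uproj.
Proof.
split.
- exact: uproj_morph.
- move=> _ _ [Sg [w [p [-> g]]]] [Sg' [w' [p' [-> g']]]]; rewrite lev_annot => l.
  by rewrite /uproj /= => e; rewrite -e !annot_low.
- move=> p np l; exists (annot (fun=> True) None p) => //.
  by apply/unodeE/good_low.
- have agree (s : utree -> Prop) (p : utree) : nd p -> lev p <= k ->
      s p <-> s (uproj p, None, None).
    by case=> Sg [w [q [-> g]]]; rewrite lev_annot => l; rewrite !annot_low.
  move=> b; have [->|/eqP nb] := eqVneq b bI.
  + exists mover_phi; split; [exact: mover_local|exact: mover_qstrat| |exact: mover_lift].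
    move=> s _ p np l; rewrite (agree s) // /mover_phi ifT //.
  + have -> : b = ~~ bI by move: nb; case: b; case: bI.
    exists resp_phi; split; [exact: resp_local|exact: resp_qstrat| |exact: resp_lift].
    by move=> s _ p np l; rewrite (agree s) // /resp_phi ifT.
Qed.

End Unravel.

(** * Inverse limits of coverings *)

Section Limit.
Variables (T : nat -> tree) (f : forall n, T n.+1 -> T n) (k : nat).
Hypothesis Hf : forall n, covers (k + n) (@f n).

Local Notation S := {n : nat & T n}.
Implicit Types s t : S.

Definition inS n (p : T n) : S := existT (fun n => T n : Type) n p.

(* The positions of all trees are put into one type: [stg s] is the index of the
   tree containing [s], and [down] maps the n.+1-st tree to the n-th one. *)
Definition stg s : nat := projT1 s.
Definition lnd s := nd (projT2 s).
Definition llev s := lev (projT2 s).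
Definition lpar s : S := inS (par (projT2 s)).
Definition down s : S :=
  match s with
  | existT 0 p => inS p
  | existT n.+1 p => inS (f p)
  end.

Lemma inS_eta s : inS (projT2 s) = s. Proof. by case: s. Qed.

Lemma stg_down s : stg (down s) = (stg s).-1. Proof. by case: s => -[]. Qed.

Lemma lnd_down s : lnd s -> lnd (down s).
Proof. by case: s => -[|n] p //= np; have [/(_ p np)[]] := Hf n. Qed.

Lemma llev_down s : lnd s -> llev (down s) = llev s.
Proof. by case: s => -[|n] p //= np; have [/(_ p np)[]] := Hf n. Qed.

Lemma down_par s : lnd s -> 0 < llev s -> down (lpar s) = lpar (down s).
Proof.
case: s => -[|n] p //= np lp; have [/(_ p np)[_ _ h] _ _ _] := Hf n.
by rewrite /lpar /= h.
Qed.

Lemma inS_inj n (p q : T n) : inS p = inS q -> p = q.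
Proof. exact: (inj_pair2_eq_dec _ Nat.eq_dec). Qed.

Lemma down_inj s t : lnd s -> lnd t -> stg s = stg t -> 0 < stg s ->
  llev s <= k + (stg s).-1 -> down s = down t -> s = t.
Proof.
case: s => -[|n] p //; case: t => m q; rewrite /stg /= => np nq e _; case: m / e q nq.
move=> q nq lp /inS_inj e; have [_ h _ _] := Hf n.
by rewrite (h p q).
Qed.

Lemma down_surj s : lnd s -> llev s <= k + stg s ->
  exists t, [/\ lnd t, stg t = (stg s).+1 & down t = s].
Proof.
case: s => n p np lp; have [_ _ h _] := Hf n; have [q nq e] := h p np lp.
by exists (inS q); split=> //=; rewrite e.
Qed.

Lemma iter_stg d s : stg (iter d down s) = stg s - d.
Proof. by elim: d => [|d IH] /=; rewrite ?subn0 // stg_down IH subnS. Qed.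

Lemma iter_lnd d s : lnd s -> lnd (iter d down s).
Proof. by move=> h; elim: d => //= d; exact: lnd_down. Qed.

Lemma iter_llev d s : lnd s -> llev (iter d down s) = llev s.
Proof. by move=> h; elim: d => //= d <-; rewrite llev_down //; exact: iter_lnd. Qed.

Lemma iter_par d s : lnd s -> 0 < llev s -> iter d down (lpar s) = lpar (iter d down s).
Proof.
move=> ns ls; elim: d => //= d ->; rewrite down_par ?iter_llev //; exact: iter_lnd.
Qed.

Lemma iter_inj d s t : lnd s -> lnd t -> stg s = stg t -> d <= stg s ->
  llev s <= k + (stg s - d) -> iter d down s = iter d down t -> s = t.
Proof.
move=> ns nt e; elim: d => [//|d IH] ds ls /= h; apply: IH; first exact: ltnW.
  by rewrite (leq_trans ls) // leq_add2l leq_sub2l.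
apply: down_inj h; rewrite ?iter_stg ?e -?e ?subn_gt0 ?iter_llev //; [exact: iter_lnd..|].
by rewrite -subnS.
Qed.

Lemma iter_surj d t : lnd t -> llev t <= k + stg t ->
  exists s, [/\ lnd s, stg s = stg t + d & iter d down s = t].
Proof.
move=> nt lt; elim: d => [|d [s [ns es h]]]; first by exists t; rewrite addn0.
have ls : llev s <= k + stg s.
  by rewrite -(iter_llev d ns) h es (leq_trans lt) // leq_add2l leq_addr.
have [s' [ns' es' h']] := down_surj ns ls.
by exists s'; split=> //; rewrite ?es' ?es ?addnS // iterSr h'.
Qed.

(* Level [n] of the limit is level [n] of the n-th tree. *)
Definition lim_nd s := lnd s /\ llev s = stg s.
Definition lim_par s := down (lpar s).

Lemma lim_lev_par s : stg (lim_par s) = (stg s).-1.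
Proof. by rewrite stg_down. Qed.

Lemma lim_nd_par s : lim_nd s -> lim_nd (lim_par s).
Proof.
move=> [ns ls]; have nps : lnd (lpar s) by apply: nd_par.
split; first exact: lnd_down.
by rewrite llev_down // lim_lev_par -ls; exact: lev_par.
Qed.

Lemma lim_ext s : lim_nd s ->
  exists t, [/\ lim_nd t, lim_par t = s & stg t = (stg s).+1].
Proof.
move=> [ns ls]; have [|t [nt et dt]] := down_surj ns; first by rewrite ls leq_addl.
have [q [nq eq lq]] := nd_ext nt.
exists (inS q); split=> //.
  split=> //; rewrite /llev /= lq; rewrite [RHS]et -ls -dt llev_down //.
by rewrite /lim_par -[RHS]dt; congr down; rewrite -[RHS]inS_eta -eq.
Qed.

Definition lim := Tree lim_lev_par lim_nd_par lim_ext.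

Fixpoint to0 n : T n -> T 0 := if n is n.+1 then fun p => to0 (f p) else id.

Definition lim_proj (s : lim) : T 0 := to0 (projT2 s).

Lemma to0_morph n : tree_morph (@to0 n).
Proof.
elim: n => [|n IH]; first by move=> p np.
by have [fm _ _ _] := Hf n; exact: (morph_comp fm IH).
Qed.

Lemma to0_inj n (p q : T n) : nd p -> nd q -> lev p <= k -> to0 p = to0 q -> p = q.
Proof.
elim: n p q => //= n IH p q np nq lp e; have [fm fi _ _] := Hf n.
have [np' lp' _] := fm p np; have [nq' lq' _] := fm q nq.
by apply: fi => //; [rewrite (leq_trans lp) // leq_addr|apply: IH => //; rewrite lp'].
Qed.

Lemma to0_surj n (p : T 0) : nd p -> lev p <= k -> exists2 q : T n, nd q & to0 q = p.
Proof.
move=> np lp; elim: n => [|n [q nq e]]; first by exists p.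
have [fm _ fs _] := Hf n; have [_ lq _] := to0_morph nq.
have [|q' nq' e'] := fs q nq; first by rewrite -lq e (leq_trans lp) // leq_addr.
by exists q' => //=; rewrite e'.
Qed.

Section LimitLift.
Variable b : bool.
Let phi n := sval (cid (let: And4 _ _ _ h := Hf n in h b)).
Let phiP n : lifting (k + n) (@f n) b (@phi n).
Proof. by rewrite /phi; case: cid. Qed.

(* [lift1] pushes a family of strategies, one for each stage, down by one stage.
   [tau] is the quasi-strategy [sg] cut off at level [n] in the n-th tree, and
   [psi] is the limit of the strategies obtained from it by repeated pushing. *)
Definition lift1 (X : S -> Prop) s :=
  phi (fun q : T (stg s).+1 => X (inS q)) (projT2 s).

Section Fixed.
Variable sg : lim -> Prop.
Definition tau s := llev s <= stg s -> sg (iter (stg s - llev s) down s).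
Definition psi s := iter (llev s) lift1 tau s.

Lemma lift1_local m (X X' : S -> Prop) :
  (forall s, lnd s -> llev s <= m -> (X s <-> X' s)) ->
  forall s, lnd s -> llev s <= m -> (lift1 X s <-> lift1 X' s).
Proof.
move=> h [n p] np lp; case: (phiP n) => hl _ _ _.
by apply: (hl m) => // q nq lq; exact: h.
Qed.

Hypothesis qsg : qstrat b sg.

Lemma tau_down s : lnd s -> llev s < stg s -> tau s <-> tau (down s).
Proof.
move=> ns ls; rewrite /tau llev_down // stg_down (ltnW ls).
have -> : llev s <= (stg s).-1 by rewrite -ltnS prednK // (leq_trans _ ls).
have -> : stg s - llev s = ((stg s).-1 - llev s).+1.
  by rewrite -subSn ?prednK ?(leq_trans _ ls) // -ltnS prednK // (leq_trans _ ls).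
by rewrite iterSr.
Qed.

Lemma tau_diag s : lim_nd s -> tau s <-> sg s.
Proof. by move=> [ns ls]; rewrite /tau ls leqnn subnn; split=> [/(_ isT)|]. Qed.

Lemma lim_node s : lnd s -> llev s <= stg s -> lim_nd (iter (stg s - llev s) down s).
Proof.
by move=> ns ls; split; [exact: iter_lnd|rewrite iter_llev // iter_stg subKn].
Qed.

(** A child offered by [sg] lives one level below [p] in the stage of that level; it is lifted to
    stage [n] by [iter_surj], and [iter_inj] shows that its parent there is [p]. *)
Lemma tau_qstrat n : qstrat b (fun p : T n => tau (inS p)).
Proof.
have [q0 qs] := qsg; split=> [p np lp|p np tp].
  move=> ls; apply: q0; first exact: lim_node.
  by rewrite [lev _]iter_stg subKn.
rewrite /serves; have [le|lt] := leqP n (lev p).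
  have [q [nq eq lq]] := nd_ext np.
  have tauT q' : child p q' -> tau (inS q').
    by move=> [_ _ l]; rewrite /tau /llev /stg /= l => h; have := leq_trans h le; rewrite ltnn.
  by case: ifP => // _; exists q => //; apply: tauT.
set s : S := inS p; have ns : lnd s by [].
have ls : llev s <= stg s by exact: ltnW.
have st := lim_node ns ls; set s0 := iter _ _ _ in st.
have s0s : stg s0 = lev p by rewrite iter_stg subKn.
have dE : stg s - llev s = (n - (lev p).+1).+1 by rewrite -subSn.
have key (q : S) : lnd q -> 0 < llev q ->
    iter (n - (lev p).+1).+1 down (lpar q) = lim_par (iter (n - (lev p).+1) down q).
  by move=> nq lq; rewrite iterS iter_par.
have : serves b sg (s0 : lim) by exact: (qs _ st (tp ls)).
rewrite /serves [lev _]s0s; case: ifP => _; last first.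
- move=> h q pq; have [nq eq lq] := pq; set t : S := inS q.
  have nt : lnd t by [].
  have lt' : llev t <= stg t by rewrite /llev /= lq.
  have dt : stg t - llev t = n - (lev p).+1 by rewrite /llev /= lq.
  move=> _; apply: h; split; first exact: lim_node.
    have := key t nt; rewrite {1}/llev /= lq => /(_ isT).
    by rewrite dt => <-; rewrite /s0 dE /lpar /= eq.
  by rewrite [lev _]iter_stg subKn // [lev (s0 : lim)]s0s.
- case=> t [[nt lt'] et]; rewrite [lev _]/(stg t) [lev _]s0s => st' sgt.
  have [|q [nq eq hq]] := iter_surj (n - (lev p).+1) nt.
    by rewrite lt' leq_addl.
  move: eq; rewrite [stg t]st' subnKC // => eq.
  case: q eq nq hq => m q; rewrite /stg /= => e; case: _ / (esym e) q => q {m e} nq hq.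
  have lq : lev q = (lev p).+1 by rewrite -[lev q](iter_llev (n - (lev p).+1) nq) hq lt'.
  exists q.
    split=> //; apply: inS_inj.
    apply: (@iter_inj (n - (lev p).+1).+1 (inS (par q)) s) => //.
    + by apply: nd_par.
    + by rewrite /stg /= -subSn // subSS leq_subr.
    + by rewrite /stg /= -subSn // subSS subKn ?(ltnW lt) // /llev /= lev_par lq leq_addl.
    + rewrite -[inS (par q)]/(lpar (inS q)) key //; last by rewrite [llev _]lq.
      by rewrite [iter _ down (inS q)]hq -dE; exact: et.
  by move=> _; rewrite [llev _]lq (erefl : stg (inS q) = n) [iter _ down (inS q)]hq.
Qed.

Lemma iter_qstrat d n : qstrat b (fun p : T n => iter d lift1 tau (inS p)).
Proof.
elim: d n => [|d IH] n /=; first exact: tau_qstrat.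
by case: (phiP n) => _ h _ _; exact: h (IH n.+1).
Qed.

(** A further push changes nothing at low levels, where a lifting agrees with its argument; locality
    carries this through the other [d] pushes. *)
Lemma iter_stable d s : lnd s -> llev s <= stg s + d ->
  iter d.+1 lift1 tau s <-> iter d lift1 tau s.
Proof.
elim: d s => [|d IH] [n p] np lp.
  rewrite addn0 in lp; have [fm _ fs _] := Hf n.
  have [|q nq e] := fs p np; first by rewrite (leq_trans lp) // leq_addl.
  case: (phiP n) => _ _ h _; have [_ lq _] := fm q nq.
  have lq' : lev q <= n by rewrite -lq e.
  rewrite /= /lift1 /= -e.
  rewrite (h _ (tau_qstrat n.+1)) //; last by rewrite (leq_trans lq') // leq_addl.
  exact: (@tau_down (inS q)).
case: (phiP n) => h _ _ _; apply: (h (lev p)) => // q nq lq.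
by apply: IH => //; rewrite /llev /stg /= (leq_trans lq) // addSnnS.
Qed.

Lemma iter_stableW d e s : lnd s -> llev s <= stg s + d -> d <= e ->
  iter e lift1 tau s <-> iter d lift1 tau s.
Proof.
move=> ns ls /subnK <-; elim: (e - d) => [//|m IH].
rewrite -IH; apply: iter_stable => //.
by rewrite (leq_trans ls) // leq_add2l leq_addl.
Qed.

Lemma psiE e s : lnd s -> llev s <= stg s + e -> psi s <-> iter e lift1 tau s.
Proof.
move=> ns le; case: (leqP (llev s) e) => [h|/ltnW h].
  by symmetry; apply: iter_stableW => //; rewrite leq_addl.
exact: iter_stableW.
Qed.

Lemma psi_qstrat n : qstrat b (fun p : T n => psi (inS p)).
Proof.
split=> [p np lp|p np sp].
  by rewrite /psi [llev _]lp; exact: (iter_qstrat 0 n).1.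
have [_ h] := iter_qstrat (lev p).+1 n.
have sp' : iter (lev p).+1 lift1 tau (inS p).
  by rewrite -psiE //; rewrite [llev _]/(lev p) addnS leqW // leq_addl.
have := h p np sp'; apply: serves_sub => q [nq _ lq] sq.
rewrite (@psiE (lev p).+1) //; by rewrite [llev _]lq leq_addl.
Qed.

Lemma psi_lift n p : nd p ->
  psi (inS p) <-> phi (fun q : T n.+1 => psi (inS q)) p.
Proof.
move=> np; rewrite (@psiE (lev p).+1) //; last by rewrite [llev _]/(lev p) addnS leqW // leq_addl.
case: (phiP n) => h _ _ _; apply: (h (lev p)) => // q nq lq.
by symmetry; apply: psiE => //; rewrite (leq_trans lq) // leq_addl.
Qed.

Lemma psi_diag s : lim_nd s -> psi s <-> sg s.
Proof.
move=> ns; rewrite -tau_diag // (@psiE 0) //; first by case: ns.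
by rewrite addn0; case: ns => _ ->.
Qed.

Lemma psi_to0 n (p : T n) : nd p -> lev p <= k -> psi (inS (to0 p)) <-> psi (inS p).
Proof.
elim: n p => //= n IH p np lp; have [/(_ p np)[nf lf _] _ _ _] := Hf n.
rewrite IH ?lf // psi_lift //; case: (phiP n) => _ _ h _.
by apply: (h _ (psi_qstrat n.+1)) => //; rewrite (leq_trans lp) // leq_addr.
Qed.

(** The play is lifted from each stage to the next, and the diagonal of these plays is a play of the
    limit. *)
Lemma psi_play (x : nat -> T 0) : play x -> (forall n, psi (inS (x n))) ->
  exists y : nat -> lim,
    [/\ play y, forall n, sg (y n) & forall n, lim_proj (y n) = x n].
Proof.
move=> px hx; pose ok n := {x : nat -> T n | play x /\ forall m, psi (inS (x m))}.
have step n (z : ok n) : exists y : ok n.+1, forall m, f (sval y m) = sval z m.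
  case: z => z [pz hz] /=; case: (phiP n) => _ _ _ h.
  have [|y [py hy ey]] := h _ (psi_qstrat n.+1) z pz.
    by move=> m; apply/psi_lift => //; exact: play_nd.
  by exists (exist _ y (conj py hy)).
pose X := fix X n : ok n :=
  if n is n.+1 then sval (cid (step n (X n))) else exist _ x (conj px hx).
have XE n m : f (sval (X n.+1) m) = sval (X n) m by move=> /=; case: cid.
have pX n : play (sval (X n)) by case: (svalP (X n)).
have dX n : lim_nd (inS (sval (X n) n)).
  by split; [exact: play_nd|exact: (play_lev n (pX n))].
exists (fun n => inS (sval (X n) n)); split=> n.
- split; [exact: dX|by []|].
  change (inS (f (par (sval (X n.+1) n.+1))) = inS (sval (X n) n)).
  by have [_ _ ->] := pX n.+1 n; rewrite XE.
- by apply/psi_diag => //; case: (svalP (X n)).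
- have E i : to0 (sval (X i) n) = x n by elim: i => // i IH; exact: etrans (congr1 (@to0 i) (XE i n)) IH.
  exact: E.
Qed.

End Fixed.

Definition lim_phi (sg : lim -> Prop) (p : T 0) := psi sg (inS p).

Lemma tau_local n (sg sg' : lim -> Prop) :
  (forall s : lim, nd s -> lev s <= n -> (sg s <-> sg' s)) ->
  forall s, lnd s -> llev s <= n -> tau sg s <-> tau sg' s.
Proof.
move=> h s ns ls; rewrite /tau; have [le|lt] := leqP (llev s) (stg s); last by split.
have hs : sg (iter (stg s - llev s) down s) <-> sg' (iter (stg s - llev s) down s).
  by apply: h; [exact: lim_node|rewrite [lev _]iter_stg subKn].
by split=> H _; apply/hs; exact: H.
Qed.

Lemma lim_phi_lifting : lifting k lim_proj b lim_phi.
Proof.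
split.
- move=> n sg sg' h p np lp; rewrite /lim_phi /psi.
  have H d (s : {n & T n}) : lnd s -> llev s <= n ->
      iter d lift1 (tau sg) s <-> iter d lift1 (tau sg') s.
    elim: d s => [|d IH] s ns ls; first exact: tau_local ns ls.
    exact: lift1_local ns ls.
  exact: H.
- by move=> sg qsg; exact: psi_qstrat.
- move=> sg qsg p [np lp] lk; rewrite /lim_phi /lim_proj psi_to0 //.
    by rewrite inS_eta psi_diag.
  by rewrite -[lev _]/(llev p) lp.
- by move=> sg qsg x px hx; exact: psi_play.
Qed.

End LimitLift.

Lemma lim_proj_morph : tree_morph lim_proj.
Proof.
move=> s [ns ls]; have [n0 l0 p0] := to0_morph ns; split=> //; first by rewrite [LHS]l0.
case: s ns ls n0 l0 p0 => -[|n] p //= np lp n0 l0 p0 _.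
by rewrite -p0 ?lp // [lev p]lp.
Qed.

Lemma lim_covers : covers k lim_proj.
Proof.
split.
- exact: lim_proj_morph.
- move=> s t ns nt ls e; have [_ l1 _] := lim_proj_morph ns.
  have [_ l2 _] := lim_proj_morph nt.
  have e' : stg s = stg t by rewrite -[LHS]l1 -[RHS]l2 e.
  case: s t ns nt ls e e' {l1 l2} => n p [m q] [np lp] [nq lq] ls e.
  rewrite /stg /= => e'; case: m / e' q nq lq e => q nq lq e.
  congr (inS _); apply: to0_inj e => //; by rewrite -[lev p]/(llev (inS p)) lp.
- move=> p np lp; have [q nq e] := to0_surj (lev p) np lp.
  exists (inS q) => //; split=> //; rewrite -[llev _]/(lev q).
  by have [_ <- _] := to0_morph nq; rewrite e.
- by move=> b; exists (lim_phi b); exact: lim_phi_lifting.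
Qed.

Lemma to0_down s : to0 (projT2 (down s)) = to0 (projT2 s).
Proof. by case: s => -[|n]. Qed.

Lemma to0_lpar s : lnd s -> 0 < llev s -> to0 (projT2 (lpar s)) = par (to0 (projT2 s)).
Proof. by move=> ns; have [_ _] := to0_morph ns. Qed.

Lemma lpar_iter m s : lnd s -> lnd (iter m lpar s) /\ llev (iter m lpar s) = llev s - m.
Proof.
move=> ns; elim: m => [|m [IH1 IH2]] /=; first by rewrite subn0.
by split; [exact: nd_par|rewrite [LHS]lev_par [lev _]IH2 subnS].
Qed.

Lemma stg_lpar m s : stg (iter m lpar s) = stg s.
Proof. by elim: m => //= m <-. Qed.

Lemma stg_inS s i : stg s = i -> exists p : T i, inS p = s.
Proof. by case: s => n p <-; exists p. Qed.

(** For [m < i] the position [x m] lives at too early a stage. Therefore [x' m] is read off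
    [x (m + i)]: going down [m] stages reaches stage [i], and [i] parents reach level [m]. This
    delay explains [n + i] in the last clause. *)
Lemma lim_stage i (x : nat -> lim) : play x -> exists x' : nat -> T i,
  [/\ play x', forall m, to0 (x' m) = lim_proj (x m) &
      forall y n, play y -> y (n + i) = x (n + i) ->
      exists y' : nat -> T i,
        [/\ play y', forall m, to0 (y' m) = lim_proj (y m) & y' n = x' n]].
Proof.
pose w (x : nat -> lim) m : {n : nat & T n} := iter i lpar (iter m down (x (m + i))).
have nx (z : nat -> lim) n : play z -> lnd (z n) /\ llev (z n) = n.
  by move=> pz; have [[n1 l1] l2 _] := pz n; split=> //; rewrite l1; exact: l2.
suff H (z : nat -> lim) : play z -> exists z' : nat -> T i,
    [/\ play z', forall m, to0 (z' m) = lim_proj (z m) & forall m, inS (z' m) = w z m].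
  move=> px; have [x' [px' ex hx]] := H x px; exists x'; split=> // y n py e.
  have [y' [py' ey hy]] := H y py; exists y'; split=> //.
  by apply: inS_inj; rewrite hx hy /w e.
move=> pz; have /choice[z' hz] : forall m, exists p : T i, inS p = w z m.
  move=> m; apply: stg_inS; rewrite stg_lpar iter_stg; have [_ e _] := pz (m + i).
  by rewrite [stg _]e addKn.
have nw m : lnd (w z m) /\ llev (w z m) = m.
  have [n1 l1] := nx z (m + i) pz.
  have [n2 l2] := lpar_iter i (iter_lnd m n1).
  by split=> //; rewrite l2 iter_llev // l1 addnK.
exists z'; split=> // m; last first.
  have [n1 l1] := nx z (m + i) pz.
  have pj := morph_play lim_proj_morph pz.
  have -> : to0 (z' m) = to0 (projT2 (w z m)) by rewrite -hz.
  have E j : to0 (projT2 (iter j down (z (m + i)))) = lim_proj (z (m + i)).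
    by elim: j => // j IH; rewrite iterS to0_down.
  have E2 j : j <= i -> to0 (projT2 (iter j lpar (iter m down (z (m + i))))) =
      iter j par (lim_proj (z (m + i))).
    elim: j => [|j IH] ji; first exact: E.
    have [n2 l2] := lpar_iter j (iter_lnd m n1).
    rewrite !iterS to0_lpar // ?IH ?(ltnW ji) // l2 iter_llev // l1 subn_gt0.
    by rewrite (leq_trans ji) // leq_addl.
  rewrite E2 //; have [_ e] := play_desc pj (leq_addr i m).
  by rewrite -[RHS]e !play_lev // addKn.
have [n1 l1] := nw m; have [n2 l2] := nw m.+1; split.
- by rewrite -hz in n1.
- by rewrite -hz in l1.
- apply: inS_inj; rewrite -[LHS]/(lpar (inS (z' m.+1))) !hz /w.
  have [n3 l3] := nx z (m.+1 + i) pz.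
  rewrite -iterS iterSr iterSr; congr (iter i lpar _).
  rewrite -iter_par ?lnd_down ?llev_down ?l3 //; last exact: lnd_down.
  congr (iter m down _).
  rewrite -down_par ?l3 //; have [_ _ <-] := pz (m + i); by rewrite addSn.
Qed.

End Limit.

(** * Borel determinacy *)

(** This says that [A] is clopen in the space of plays. *)
Definition decided (T : tree) (A : (nat -> T) -> Prop) :=
  forall x, play x -> exists n, forall y, play y -> y n = x n -> (A x <-> A y).

(* Quantifying over the trees above [T] makes this property stable under
   countable unions. *)
Definition unravelable (T : tree) (A : (nat -> T) -> Prop) :=
  forall (T' : tree) (g : T' -> T), tree_morph g -> forall k,
  exists (T'' : tree) (h : T'' -> T'), covers k h /\ decided (fun x => A (g \o (h \o x))).

Lemma unravelable_ext (T : tree) (A B : (nat -> T) -> Prop) :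
  (forall x, play x -> (A x <-> B x)) -> unravelable A -> unravelable B.
Proof.
move=> AB uA T' g gm k; have [T'' [h [ch dh]]] := uA T' g gm k.
exists T'', h; split=> // x px; have [n hn] := dh x px; exists n => y py e.
have pg z : play z -> play (g \o (h \o z)).
  by move=> pz; apply: morph_play => //; apply: morph_play pz; case: ch.
by rewrite -!AB; [exact: hn|exact: pg..].
Qed.

Lemma unravelable_not (T : tree) (A : (nat -> T) -> Prop) :
  unravelable A -> unravelable (fun x => ~ A x).
Proof.
move=> uA T' g gm k; have [T'' [h [ch dh]]] := uA T' g gm k.
exists T'', h; split=> // x px; have [n hn] := dh x px; exists n => y py e.
by rewrite (hn y py e).
Qed.

(** At level [k.+2] the answer is on record. Unless the play has met the set already, [Some u]
    guarantees a later visit and [None] excludes one. *)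
Lemma unravelable_open (T : tree) (U : T -> Prop) :
  unravelable (fun x => exists n, U (x n)).
Proof.
move=> T' g gm k; pose V p := U (g p).
exists (utree k V), (@uproj _ k V); split; first exact: uproj_covers.
move=> x px; exists k.+2 => y py e.
have low (z : nat -> utree k V) n : play z -> n <= k.+2 -> z n = iter (k.+2 - n) par (z k.+2).
  by move=> pz /(play_desc pz)[_ <-]; rewrite !play_lev.
have [[n nk Un]|nlow] := pselect (exists2 n, n <= k.+2 & V (uproj (x n))).
  split=> _; exists n => //=; move: Un; rewrite low //; by rewrite -e -low.
have nlow' n : n <= k.+2 -> ~ V (uproj (x n)) /\ ~ V (uproj (y n)).
  move=> nk; split=> Vn; apply: nlow; exists n => //.
  by rewrite low // -e -low.
have [[Sg [w [p [xE g2]]]] l2 _] := px k.+2.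
have lp : lev p = k.+2 by rewrite -l2 xE.
have tail (z : nat -> utree k V) : play z -> z k.+2 = x k.+2 -> forall n, k.+2 <= n ->
    exists q, [/\ z n = annot k Sg w q, good k V Sg w q & lev q = n].
  move=> pz ez n /subnK <-; elim: (n - k.+2) => [|d [q [zq gq lq]]].
    by exists p; rewrite add0n ez.
  have := play_child (d + k.+2) pz; rewrite zq => /child_high[|r [zr qr gr]].
    by rewrite lq addnS ltnS leq_addl.
  by exists r; split=> //; case: qr => _ _ ->; rewrite lq.
suff H (z : nat -> utree k V) : play z -> z k.+2 = x k.+2 ->
    (forall n, n <= k.+2 -> ~ V (uproj (z n))) ->
    (exists n, V (uproj (z n))) <-> w <> None.
  rewrite (H x px) //; last by move=> n /nlow'[].
  by rewrite (H y py) //; move=> n /nlow'[].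
move=> pz ez nz; split.
  case=> n Vn wN; have [/nz//|/ltnW kn] := leqP n k.+2.
  have [q [zq gq lq]] := tail z pz ez n kn; rewrite wN in gq.
  apply: (good_nlose gq); first by rewrite lq.
  apply: force_hit; split; [by move: Vn; rewrite zq|by rewrite lq|].
  by apply: good_mem gq _; rewrite lq ltnW.
case: w xE g2 tail => // u xE g2 tail _.
have [_ _] := good_legal g2; rewrite lp => /(_ (leqnn _))[[Vu ku Su] nu _].
exists (lev u); have [q [zq gq lq]] := tail z pz ez (lev u) ku.
have [_ _] := good_legal gq; rewrite lq => /(_ ku)[_ _ /(_ (leqnn _)) d].
by rewrite zq /uproj /= (desc_eq d).
Qed.

Section Union.
Variables (T : tree) (A : nat -> (nat -> T) -> Prop).
Hypothesis uA : forall n, unravelable (A n).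
Variables (T0 : tree) (g : T0 -> T) (k : nat).
Hypothesis gm : tree_morph g.

Record stage := Stage {
  stage_tree : tree;
  stage_map : stage_tree -> T0;
  stage_morph : tree_morph stage_map
}.

Record extension n (Q : stage) := Extension {
  ext_tree : tree;
  ext_map : ext_tree -> stage_tree Q;
  ext_covers : covers (k + n) ext_map;
  ext_decided : decided (fun x => A n (g \o (@stage_map Q \o (ext_map \o x))))
}.

Lemma extension_exists n Q : exists e : extension n Q, True.
Proof.
have [T'' [h [ch dh]]] := uA n (morph_comp (@stage_morph Q) gm) (k + n).
by exists (Extension ch dh).
Qed.

Definition next_extension n Q : extension n Q := sval (cid (extension_exists n Q)).

Lemma ext_morph n Q (e : extension n Q) : tree_morph (@stage_map Q \o @ext_map n Q e).
Proof. by apply: morph_comp (@stage_morph Q); case: (ext_covers e). Qed.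

Fixpoint tower n : stage :=
  if n is n.+1 then Stage (@ext_morph _ _ (next_extension n (tower n)))
  else @Stage T0 id (fun p np => And3 np erefl (fun _ => erefl)).

Definition tower_map n : stage_tree (tower n.+1) -> stage_tree (tower n) :=
  @ext_map _ _ (next_extension n (tower n)).

Lemma tower_covers n : covers (k + n) (@tower_map n).
Proof. exact: ext_covers. Qed.

Lemma tower_to0 n (p : stage_tree (tower n)) : stage_map p = to0 tower_map p.
Proof. by elim: n p => //= n IH p; rewrite IH. Qed.

(** [A i] is clopen at stage [i.+1], and by [lim_stage] finitely much of a limit play determines its
    trace there. So the union is open in the limit. *)
Lemma tower_union : exists (T'' : tree) (h : T'' -> T0),
  covers k h /\ decided (fun x => exists n, A n (g \o (h \o x))).
Proof.
pose L := lim tower_covers; pose pr : L -> T0 := @lim_proj _ _ _ tower_covers.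
pose B (x : nat -> L) := exists n, A n (g \o (pr \o x)).
have cL : covers k pr := lim_covers tower_covers.
have uB : unravelable B.
  pose V (s : L) := forall x, play x -> x (lev s) = s -> B x.
  apply: unravelable_ext (@unravelable_open L V) => x px; split.
    by case=> n Vn; apply: Vn; rewrite ?play_lev.
  case=> i Ai; have [x' [px' ex hx]] := lim_stage i.+1 px.
  have [n hn] := ext_decided px'.
  have AE (y : nat -> L) (y' : nat -> stage_tree (tower i.+1)) :
      (forall m, to0 tower_map (y' m) = pr (y m)) ->
      A i (g \o (@stage_map (tower i) \o (@tower_map i \o y'))) = A i (g \o (pr \o y)).
    move=> e; congr (A i _); apply/funext => m /=; rewrite -e; congr (g _).
    exact: tower_to0.
  exists (n + i.+1) => y py e; rewrite play_lev // in e.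
  have [y' [py' ey e']] := hx y n py e.
  exists i; rewrite -(AE y y' ey); apply/(hn y' py' e').
  by rewrite (AE x x' ex).
have [T'' [h [ch dh]]] := uB L id (fun p np => And3 np erefl (fun _ => erefl)) k.
by exists T'', (pr \o h); split; [exact: covers_comp|].
Qed.

End Union.

Lemma unravelable_union (T : tree) (A : nat -> (nat -> T) -> Prop) :
  (forall n, unravelable (A n)) -> unravelable (fun x => exists n, A n x).
Proof. by move=> uA T' g gm k; exact: tower_union. Qed.

(** The clopen game upstairs is settled by the Gale-Stewart argument and the strategy is pushed down
    by the lifting. The root has to be unique because a quasi-strategy contains all roots, while the
    winner could vary with the root. *)
Theorem determinacy (T : tree) (A : (nat -> T) -> Prop) (b : bool) (r : T) :
  nd r -> lev r = 0 -> (forall p : T, nd p -> lev p = 0 -> p = r) ->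
  unravelable A ->
  (exists s, qstrat b s /\ forall x, play x -> (forall n, s (x n)) -> A x) \/
  (exists s, qstrat (~~ b) s /\ forall x, play x -> (forall n, s (x n)) -> ~ A x).
Proof.
move=> nr lr ur uA.
have [T' [h [ch dh]]] := uA T id (fun p np => And3 np erefl (fun _ => erefl)) 0.
pose A' x := A (h \o x); rewrite -/A' in dh.
have [hm hi hs hl] := ch.
suff : (exists s, qstrat b s /\ forall x : nat -> T', play x -> (forall n, s (x n)) -> A' x) \/
  (exists s, qstrat (~~ b) s /\ forall x : nat -> T', play x -> (forall n, s (x n)) -> ~ A' x).
  have down_ c (P : (nat -> T) -> Prop) : (exists s, qstrat c s /\
      forall x : nat -> T', play x -> (forall n, s (x n)) -> P (h \o x)) ->
      exists s, qstrat c s /\ forall x, play x -> (forall n, s (x n)) -> P x.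
    case=> s [qs hP]; have [phi [_ q _ l]] := hl c.
    exists (phi s); split=> [|x px sx]; first exact: q.
    have [y [py sy ey]] := l s qs x px sx.
    by have -> : x = h \o y; [apply/funext => n /=|exact: hP].
  by case=> H; [left; exact: down_ H|right; exact: (down_ _ (fun x => ~ A x) H)].
have [r' nr' er'] : exists2 r', nd r' & h r' = r by apply: hs; rewrite ?lr.
have lr' : lev r' = 0 by have [_ <- _] := hm r' nr'; rewrite er'.
have ur' p : nd p -> lev p = 0 -> p = r'.
  move=> np lp; apply: hi => //; first by rewrite lp.
  by rewrite er'; have [? l _] := hm p np; apply: ur; rewrite ?l.
pose V (p : T') := nd p /\ forall x, play x -> x (lev p) = p -> A' x.
have [Fr|nFr] := pselect (force b (fun=> True) V r'); [left|right].
- have [//|//|Y [[Yr Yd Ys Yx] _]] := force_drives _ _ Fr.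
  (* [Y] is only a strategy until [V] is hit; below [V] the game is won and all moves are
     allowed. *)
  exists (fun p => Y p \/ exists2 q, V q & desc q p); split.
    split=> [p np lp|p np]; first by left; rewrite (ur' p).
    case=> [Yp|[q Vq qp]]; last first.
      have Hc q' : child p q' -> exists2 q, V q & desc q q'.
        by move=> pq'; exists q => //; exact: child_desc qp pq'.
      rewrite /serves; case: ifP => _; last by move=> q' /Hc; right.
      have [q' [n' e' l']] := nd_ext np; have pq' : child p q' by [].
      by exists q' => //; right; exact: Hc.
    have [Vp|nVp] := pselect (V p).
      have Hc q' : child p q' -> exists2 q, V q & desc q q'.
        by move=> pq'; exists p => //; exact: child_desc (desc_refl _) pq'.
      rewrite /serves; case: ifP => _; last by move=> q' /Hc; right.
      have [q' [n' e' l']] := nd_ext np; have pq' : child p q' by [].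
      by exists q' => //; right; exact: Hc.
    by apply: serves_sub (Ys p np Yp nVp) => q _; left.
  move=> x px sx.
  have [[n [q Vq d]]|nV] := pselect (exists n, exists2 q, V q & desc q (x n)).
    apply: (Vq.2) => //; have [le _] := d; rewrite play_lev // in le.
    have d' := play_desc px le.
    by apply: desc_eq; rewrite ?play_lev //; apply: (desc_total d' d); rewrite play_lev.
  have [|n _ Vn] := Yx x 0 px (ur' _ (play_nd 0 px) (play_lev 0 px)).
    by move=> m _; case: (sx m) => // h'; case: nV; exists m.
  by apply: Vn.2 => //; rewrite play_lev.
- exists (fun p => ~ force b (fun=> True) V p); split.
    split=> [p np lp|p np]; first by rewrite (ur' p).
    apply: contra_notP; rewrite /serves; case: ifP => [/eqP o H|/eqP o H].
      apply: force_opp => [|q pq _]; first by rewrite o; case: (b).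
      by apply: contrapT => nq; apply: H; exists q.
    have /existsNP[q /not_implyP[pq /contrapT Fq]] := H.
    by apply: (force_own _ pq) => //; move: o; case: (b); case: odd.
  move=> x px sx Ax; have [n hn] := dh x px; apply: (sx n); apply: force_hit.
  split; first exact: play_nd.
  by move=> y py; rewrite play_lev // => e; apply/(hn y py e).
Qed.

(** * The space of labellings *)

(* Words represent elements of the free product of copies of Z/3, the letter
   [(i, a)] being the [a]-th power of the i-th generator; an element of [space]
   is a function of the group element. Letters are consed on the side of the
   constraint on labels, so that the group acts by [rcons]. *)
Definition letter := (nat * 'I_3)%type.
Definition word := seq letter.
Definition labelling := word -> nat -> 'I_3.

Definition respects (x : labelling) : Prop :=
  [/\ forall (u v : word) i a b, x (u ++ (i, a) :: (i, b) :: v) = x (u ++ (i, a + b)%R :: v),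
      forall (u v : word) i, x (u ++ (i, 0%R : 'I_3) :: v) = x (u ++ v) &
      forall (u : word) i a, x ((i, a) :: u) i = (x u i + a)%R].

Definition space := {x : labelling | respects x}.

Lemma space_ext (x y : space) : (forall w, sval x w = sval y w) -> x = y.
Proof. by case: x y => [x hx] [y hy] /= e; apply: eq_exist; exact/funext. Qed.

(** Each equation, read at one coordinate, involves two words; so [respects] is a closed
    condition. *)
Lemma respects_local (f : labelling) :
  (forall (s : seq word) j, exists x : space, forall w, w \in s -> f w j = sval x w j) ->
  respects f.
Proof.
move=> H; split.
- move=> u v i a b; apply/funext => j.
  have [x h] := H [:: u ++ (i, a) :: (i, b) :: v; u ++ (i, a + b)%R :: v] j.
  by rewrite !h ?inE ?eqxx ?orbT //; case: (svalP x) => -> _ _.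
- move=> u v i; apply/funext => j; have [x h] := H [:: u ++ (i, 0%R) :: v; u ++ v] j.
  by rewrite !h ?inE ?eqxx ?orbT //; case: (svalP x) => _ -> _.
- move=> u i a; have [x h] := H [:: (i, a) :: u; u] i.
  by rewrite !h ?inE ?eqxx ?orbT //; case: (svalP x) => _ _ ->.
Qed.

Lemma shift_subproof (x : space) i a : respects (fun w => sval x (rcons w (i, a))).
Proof.
case: (svalP x) => h1 h2 h3; split.
- by move=> u v j b c; rewrite !rcons_cat /= h1.
- by move=> u v j; rewrite !rcons_cat /= h2.
- by move=> u j b; exact: h3.
Qed.

Definition shift i a (x : space) : space := exist _ _ (shift_subproof x i a).

Lemma shift0 i x : shift i 0%R x = x.
Proof.
apply: space_ext => w /=; rewrite -cats1; case: (svalP x) => _ -> _.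
by rewrite cats0.
Qed.

Lemma shiftD i a b x : shift i a (shift i b x) = shift i (a + b)%R x.
Proof.
apply: space_ext => w /=; rewrite -!cats1 -catA /=; case: (svalP x) => h _ _.
exact: h.
Qed.

Lemma shift_root i a x : sval (shift i a x) [::] i = (sval x [::] i + a)%R.
Proof. by case: (svalP x) => _ _ h; exact: h. Qed.

(** Exponent sums provide a point with any prescribed root label. *)
Lemma counting_subproof (l : nat -> 'I_3) :
  respects (fun w j => (l j + \sum_(c <- w | c.1 == j) c.2)%R).
Proof.
split.
- move=> u v i a b; apply/funext => j; congr (_ + _)%R.
  rewrite !big_cat /= !big_cons /=; case: eqP => // _.
  by congr (_ + _)%R; rewrite addrA.
- move=> u v i; apply/funext => j; congr (_ + _)%R.
  by rewrite !big_cat /= big_cons /=; case: eqP => // _; rewrite add0r.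
- by move=> u i a; rewrite big_cons eqxx /= addrA addrAC.
Qed.

Definition counting (l : nat -> 'I_3) : space := exist _ _ (counting_subproof l).

Lemma counting_root l : sval (counting l) [::] = l.
Proof. by apply/funext => j /=; rewrite big_nil addr0. Qed.

(* Labels on a set [Q] with an action of the group can be pulled back along the
   orbit map of [q0]. *)
Section Act.
Variables (Q : Type) (valid : Q -> Prop) (act : letter -> Q -> Q).
Variables (lab : Q -> nat -> 'I_3) (q0 : Q).
Hypothesis act_valid : forall c q, valid q -> valid (act c q).
Hypothesis act_add : forall i a b q, valid q ->
  act (i, a) (act (i, b) q) = act (i, a + b)%R q.
Hypothesis act0 : forall i q, valid q -> act (i, 0%R) q = q.
Hypothesis act_lab : forall i a q, valid q -> lab (act (i, a) q) i = (lab q i + a)%R.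
Hypothesis q0_valid : valid q0.

Lemma foldr_valid w : valid (foldr act q0 w).
Proof. by elim: w => //= c w; exact: act_valid. Qed.

Lemma act_respects : respects (fun w => lab (foldr act q0 w)).
Proof.
split.
- by move=> u v i a b; rewrite !foldr_cat /= act_add //; exact: foldr_valid.
- by move=> u v i; rewrite !foldr_cat /= act0 //; exact: foldr_valid.
- by move=> u i a; apply: act_lab; exact: foldr_valid.
Qed.
End Act.

(** * Reduced words, and labellings assembled from pieces *)

Definition push (c : letter) (r : word) : word :=
  if r is d :: r' then
    if c.1 == d.1 then if (c.2 + d.2 == 0)%R then r' else (c.1, c.2 + d.2)%R :: r'
    else if c.2 == 0%R then r else c :: r
  else if c.2 == 0%R then r else [:: c].

Fixpoint reduced (r : word) : bool :=
  if r is c :: r' then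
    [&& c.2 != 0%R, (if r' is d :: _ then c.1 != d.1 else true) & reduced r']
  else true.

Definition reduce : word -> word := foldr push [::].

Lemma push_reduced c r : reduced r -> reduced (push c r).
Proof.
case: r => [_|d r] /=; first by case: ifP => // /= ->.
case: c d => i a [j b] /= /and3P[b0 h rr].
have [ij|ij] := eqVneq i j; last first.
  by case: ifP => [_|/= a0] /=; rewrite ?a0 ?ij ?b0 ?h.
by case: ifP => //= ab; rewrite ab rr andbT ij.
Qed.

Lemma push0 i r : reduced r -> push (i, 0%R) r = r.
Proof.
case: r => [//|[j b] r] /= /and3P[b0 _ _].
by case: eqP => [<-|_]; rewrite ?add0r ?(negbTE b0) ?eqxx.
Qed.

Lemma push_add i a b r : reduced r -> push (i, a) (push (i, b) r) = push (i, a + b)%R r.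
Proof.
case: r => [_|[j c] r] /=.
  have [->|b0] := eqVneq b 0%R; first by rewrite addr0.
  by rewrite /= eqxx.
move=> /and3P[c0 h rr]; have [ij|ij] := eqVneq i j; last first.
  have [->|b0] := eqVneq b 0%R; first by rewrite addr0 /= (negbTE ij).
  by rewrite /= eqxx.
subst j; have [bc|bc] := eqVneq (b + c)%R 0%R; last first.
  by rewrite /= eqxx addrA.
rewrite -addrA bc addr0; case: r h rr => [|[k d] r] //= h rr.
by rewrite (negbTE h).
Qed.

Lemma reduceP w : reduced (reduce w).
Proof. by elim: w => //= c w; exact: push_reduced. Qed.

Lemma push_id c r : reduced (c :: r) -> push c r = c :: r.
Proof.
by case: r => [|d r] /=; [rewrite !andbT => /negbTE ->|
  case/and3P => /negbTE -> /negbTE ->].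
Qed.

Lemma reduce_id r : reduced r -> reduce r = r.
Proof.
elim: r => // c r IH rr; rewrite /reduce /= -/(reduce r) IH ?push_id //.
by case/and3P: rr.
Qed.

Lemma space_push (x : space) u c r : sval x (u ++ push c r) = sval x (u ++ c :: r).
Proof.
case: c => i a; case: (svalP x) => h1 h2 _.
case: r => [|[j b] r] /=; first by case: eqP => // ->; rewrite h2.
have [<-|ij] := eqVneq i j; last by case: eqP => // ->; rewrite h2.
by rewrite h1 /=; case: eqP => // ->; rewrite h2.
Qed.

Lemma space_reduce (x : space) w : sval x (reduce w) = sval x w.
Proof.
rewrite -[LHS]/(sval x ([::] ++ reduce w)) -[w in RHS]/([::] ++ w).
elim: w [::] => // c w IH u.
by rewrite /reduce /= -/(reduce w) space_push -cat_rcons IH cat_rcons.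
Qed.

Definition last_index (r : word) : nat := (last (0, 0%R) r).1.

(** Multiplication on the left affects the last letter only in a one-letter word, whose index
    survives unless the word vanishes. *)
Lemma last_push c r : r != [::] -> push c r != [::] ->
  last_index (push c r) = last_index r.
Proof.
rewrite /last_index; case: r => // d r _ /=.
have [cd|_] := eqVneq c.1 d.1; last by case: (c.2 == 0%R).
by case: (c.2 + d.2 == 0)%R; case: r. 
Qed.

(* The branch of the tree in direction [i] at the root is taken from [x i]. *)
Lemma glue_subproof (x : nat -> space) :
  (forall i, sval (x i) [::] = sval (x 0) [::]) ->
  respects (fun w => let r := reduce w in sval (x (last_index r)) r).
Proof.
move=> x0; apply: (@act_respects word reduced push
   (fun r => sval (x (last_index r)) r)) => //.
- exact: push_reduced.
- exact: push_add.
- exact: push0.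
- move=> i a r rr.
  have lab_push y : (sval (x y) (push (i, a) r) i = sval (x y) r i + a)%R.
    by rewrite -[push _ _]cat0s space_push; case: (svalP (x y)) => _ _ ->.
  (* The branches meet only at the empty word, where the common root label allows passing from one
     point to another. *)
  have [r0|r0] := eqVneq r [::].
    by subst r; rewrite lab_push x0 [in RHS]x0.
  have [p0|p0] := eqVneq (push (i, a) r) [::].
    by rewrite -lab_push p0 x0 [in RHS]x0.
  by rewrite last_push.
Qed.

Definition glue x h : space := exist _ _ (@glue_subproof x h).

Lemma glueE x h r : reduced r -> sval (@glue x h) r = sval (x (last_index r)) r.
Proof. by move=> rr /=; rewrite reduce_id. Qed.

(* Words are written as [r g_i^a] with [r] not ending with the letter [i], so
   that the pair [(a, r)] stands for the position [r] in the tree hanging at the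
   vertex [a] of the triangle of the root in direction [i]. *)
Definition tpush i (c : letter) (q : 'I_3 * word) : 'I_3 * word :=
  if (q.2 == [::]) && (c.1 == i) then ((c.2 + q.1)%R, [::]) else (q.1, push c q.2).

Definition tvalid i (q : 'I_3 * word) := reduced q.2 /\ (q.2 != [::] -> last_index q.2 <> i).

Lemma tpush_valid i c q : tvalid i q -> tvalid i (tpush i c q).
Proof.
case: q => a r [/= rr hr]; rewrite /tpush /=; case: ifP => [_|/negbT]; first by split.
move=> h; split; first exact: push_reduced.
move=> /= p0; have [r0|r0] := eqVneq r [::]; last by rewrite last_push //; exact: hr.
by move: h p0; rewrite r0 eqxx /last_index /= => /eqP ci; case: ifP.
Qed.

(** Inside each hanging tree the label constraint is inherited from [z a]; the hypothesis is the
    constraint along the edges of the triangle itself. *)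
Lemma triangle_subproof i (z : 'I_3 -> space) :
  (forall a, sval (z a) [::] i = (sval (z 0%R) [::] i + a)%R) ->
  respects (fun w => let q := foldr (tpush i) (0%R, [::]) w in sval (z q.1) q.2).
Proof.
move=> hz; apply: (@act_respects _ (tvalid i) (tpush i) (fun q => sval (z q.1) q.2)) => //.
- exact: tpush_valid.
- move=> j a b [c r] [/= rr hr]; rewrite /tpush /=.
  have [->|r0] := eqVneq r [::] => /=.
    have [->|ji] := eqVneq j i => /=; first by rewrite ?eqxx /= ?addrA.
    by rewrite andbF; congr (_, _); exact: (push_add j a b (isT : reduced [::])).
  (* If the word vanished with [j = i], it would be a single letter of index [i], which [tvalid]
     excludes. *)
  rewrite [_ && _](_ : _ = false); first by rewrite push_add.
  apply/negbTE/negP => /andP[/eqP p0 /eqP ji]; subst j.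
  case: r p0 r0 rr hr => // -[k d] r /=; have [<-|ik] := eqVneq i k; last by case: eqP.
  case: eqP => // _ -> _ _ /(_ isT); exact.
- by move=> j [c r] [/= rr hr]; rewrite /tpush /= add0r push0 //; case: eqP => [->|//]; case: eqP.
- move=> j a [c r] [/= rr hr]; rewrite /tpush /=.
  case: ifP => [/andP[/eqP -> /eqP ->]|_] /=.
    by rewrite hz [in RHS]hz -addrA [(a + c)%R]addrC.
  by rewrite -[push _ _]cat0s space_push; case: (svalP (z c)) => _ _ ->.
Qed.

Definition triangle i z h : space := exist _ _ (@triangle_subproof i z h).

Lemma triangle_shift i z h a w : sval (shift i a (@triangle i z h)) w =
  let q := foldr (tpush i) (a, [::]) w in sval (z q.1) q.2.
Proof. by rewrite /= foldr_rcons /tpush /= eqxx addr0. Qed.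

Lemma foldr_tpush i a r : reduced r -> (r != [::] -> last_index r <> i) ->
  foldr (tpush i) (a, [::]) r = (a, r).
Proof.
elim: r => // c r IH rr hl /=; have [rr' r0] : reduced r /\ True by case/and3P: rr.
rewrite IH // => [|rn0]; last by move: hl; rewrite /last_index; case: (r) rn0 => // d s _ /(_ isT).
rewrite /tpush /=; case: ifP => [/andP[/eqP e /eqP ci]|_]; last by rewrite push_id.
by case: (hl isT); rewrite e.
Qed.

(** * The games *)

Section Game.
Variables (i : nat) (l : nat -> 'I_3).

(* The label of the reduced word [r] is chosen in the move leading to level
   [time r]. Player I (parity [false]) labels the words ending with [i]. *)
Definition time (r : word) : nat :=
  if r is [::] then 0 else if last_index r == i then (size r).*2.-1 else (size r).*2.

Lemma time_even m r : (time r <= m.*2) = (size r <= m).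
Proof.
case: r => // c r; rewrite /time; case: eqP => _; last by rewrite leq_double.
by rewrite /= ltn_double.
Qed.

Lemma time_odd m r : (time r <= m.*2.+1) =
  (size r <= m) || ((last_index r == i) && (size r <= m.+1)).
Proof.
case: r => // c r; rewrite /time; case: eqP => _.
  rewrite /= ltnS leq_double ltnS.
  by case: (ltngtP (size r) m).
by rewrite orbF leq_eqVlt ltnS leq_double [X in X || _](_ : _ = false) //;
  apply/eqP => /(congr1 odd); rewrite /= !odd_double.
Qed.

Lemma time_size m r : time r <= m -> size r <= m.
Proof.
by move=> h; rewrite -time_even (leq_trans h) // -addnn leq_addr.
Qed.

Definition restr n (f : labelling) : labelling :=
  fun w => if reduced w && (time w <= n) then f w else fun=> 0%R.

Lemma restr_restr m n f : m <= n -> restr m (restr n f) = restr m f.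
Proof.
move=> mn; apply/funext => w; rewrite /restr; case: reduced => //=.
by case: leqP => // h; rewrite (leq_trans h mn).
Qed.

Lemma restr_eq n f g :
  restr n f = restr n g <-> forall w, reduced w -> time w <= n -> f w = g w.
Proof.
split=> [e w rw tw|h].
  by have := congr1 (@^~ w) e; rewrite /restr rw tw.
by apply/funext => w; rewrite /restr; case: ifP => // /andP[rw tw]; exact: h.
Qed.

Definition gpos := (nat * labelling)%type.
(** Demanding an extension to a point of [space] builds the label constraints into the legality of
    moves. *)
Definition gnode (p : gpos) :=
  exists2 x : space, sval x [::] = l & p.2 = restr p.1 (sval x).
Definition gpar (p : gpos) : gpos := (p.1.-1, restr p.1.-1 p.2).

Lemma gnode_par p : gnode p -> gnode (gpar p).
Proof.
by move=> [x x0 e]; exists x; rewrite //= e restr_restr // leq_pred.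
Qed.

Lemma gnode_ext p : gnode p ->
  exists q, [/\ gnode q, gpar q = p & q.1 = p.1.+1].
Proof.
case: p => n f [x x0 /= e]; exists (n.+1, restr n.+1 (sval x)); split=> //.
  by exists x.
by rewrite /gpar /= restr_restr // e.
Qed.

Definition game := @Tree gpos gnode fst gpar (fun=> erefl) gnode_par gnode_ext.

Lemma lev_game n f : lev ((n, f) : game) = n. Proof. by []. Qed.

Lemma restr_node n (x : space) : sval x [::] = l ->
  nd ((n, restr n (sval x)) : game).
Proof. by move=> x0; exists x. Qed.

Lemma restr_child n (x : space) : sval x [::] = l ->
  child ((n, restr n (sval x)) : game) ((n.+1, restr n.+1 (sval x)) : game).
Proof.
move=> x0; split=> //; first exact: restr_node.
by rewrite [par _]/(gpar _) /gpar /= restr_restr.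
Qed.

Lemma restr_play (x : space) : sval x [::] = l ->
  play (fun n => (n, restr n (sval x)) : game).
Proof.
move=> x0 n; split=> //; first exact: restr_node.
by case: (restr_child n x0).
Qed.

Lemma child_restr n (x : space) (q : game) :
  child ((n, restr n (sval x)) : game) q -> exists y : space,
  [/\ sval y [::] = l, q = (n.+1, restr n.+1 (sval y)) &
      forall w, reduced w -> time w <= n -> sval y w = sval x w].
Proof.
case: q => m f [[y y0 /= ->]] e em; have {}em : m = n.+1 := em; subst m.
exists y; split=> //; apply/restr_eq.
by move: e => [] <-; rewrite /= restr_restr.
Qed.

Definition outcome_fun (p : nat -> game) : labelling :=
  fun w => let r := reduce w in (p (time r)).2 r.

(* The value at sequences that are not plays is junk. *)
Definition outcome (p : nat -> game) : space :=
  if pselect (respects (outcome_fun p)) is left h then exist _ _ h else counting l.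

Lemma game_play_restr (p : nat -> game) m n : play p -> m <= n ->
  (p m).2 = restr m (p n).2.
Proof.
move=> pp /subnK <-; elim: (n - m) => [|d IH].
  have [[x _ e] l0 _] := pp m; by rewrite add0n e [(p m).1]l0 restr_restr.
have [_ l1 e] := pp (d + m); have [_ l2 _] := pp (d + m).+1.
rewrite IH -e [par _]/(gpar _) /gpar /= restr_restr //.
by rewrite [(p _).1]l2 leq_addl.
Qed.

Lemma outcomeE (p : nat -> game) : play p ->
  forall n, p n = (n, restr n (sval (outcome p))).
Proof.
move=> pp.
have E n w : reduced w -> time w <= n -> (p n).2 w = outcome_fun p w.
  move=> rw tw; rewrite /outcome_fun reduce_id // (game_play_restr pp tw).
  by rewrite /restr rw leqnn.
have H : respects (outcome_fun p).
  apply: respects_local => s j; pose n := \max_(w <- s) time (reduce w).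
  have [[x x0 e] ln _] := pp n; exists x => w ws; congr (_ j).
  have tw : time (reduce w) <= n by exact: leq_bigmax_seq.
  rewrite -space_reduce -[RHS]/(sval x (reduce w)).
  have -> : outcome_fun p w = outcome_fun p (reduce w).
    by rewrite /outcome_fun /= (reduce_id (reduceP w)).
  rewrite -(E n) ?reduceP // e.
  by rewrite [(p n).1]ln /restr reduceP tw.
move=> n; have [[x x0 e] ln _] := pp n.
case: (p n) (E n) e ln => m f /= En e ln; rewrite [m]ln in e *; congr (_, _).
apply/funext => w; rewrite /restr /outcome; case: pselect => // h /=.
by case: ifP => [/andP[rw tw]|h']; [exact: En|rewrite e /restr h'].
Qed.

Lemma outcome_restr (x : space) : sval x [::] = l ->
  outcome (fun n => (n, restr n (sval x))) = x.
Proof.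
move=> x0; have pE := outcomeE (restr_play x0).
apply: space_ext => w; rewrite -[LHS]space_reduce -[RHS]space_reduce.
have [/restr_eq h] := pE (time (reduce w)).
by rewrite h // reduceP.
Qed.

End Game.

(** * Simultaneous play of strategies *)

Lemma space_limit (X : nat -> space) :
  (forall m r, reduced r -> size r <= m -> sval (X m.+1) r = sval (X m) r) ->
  exists x : space, forall m r, reduced r -> size r <= m -> sval x r = sval (X m) r.
Proof.
move=> h; have st m n r : reduced r -> size r <= m -> m <= n ->
    sval (X n) r = sval (X m) r.
  move=> rr sr /subnK <-; elim: (n - m) => // d IH.
  by rewrite addSn h // (leq_trans sr) // leq_addl.
pose f : labelling := fun w => sval (X (size (reduce w))) (reduce w).
have H : respects f.
  apply: respects_local => s j; exists (X (\max_(w <- s) size (reduce w))) => w ws; congr (_ j).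
  rewrite -[RHS]space_reduce; apply/esym/st => //; first exact: reduceP.
  exact: (@leq_bigmax_seq _ _ _ (fun w => size (reduce w))). 
exists (exist _ f H) => m r rr sr /=; rewrite /f reduce_id //.
exact/esym/st.
Qed.

Lemma reduced_rcons r c : reduced (rcons r c) ->
  reduced r /\ (r != [::] -> last_index r <> c.1).
Proof.
elim: r => // d [|e r] IH.
  by move=> /= /and3P[-> /eqP h _]; split.
move=> h; have {h}/and3P[d0 de /IH[re le]] :
  [&& d.2 != 0%R, d.1 != e.1 & reduced (rcons (e :: r) c)] by exact: h.
by split=> [|_]; [exact/and3P|exact: le].
Qed.

Lemma size_push c r : size (push c r) <= (size r).+1.
Proof.
case: r => [|d r] /=; first by case: ifP.
by case: ifP => _; case: ifP => _ //=; rewrite ltnW.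
Qed.

Lemma size_reduce w : size (reduce w) <= size w.
Proof. by elim: w => //= c w IH; exact: leq_trans (size_push _ _) _. Qed.

(* Winning strategies of player I for all [i] and the same root label are played
   simultaneously. *)
Section Covering.
Variables (l : nat -> 'I_3) (s : forall i, game i l -> Prop).
Hypothesis qs : forall i, qstrat false (@s i).

Let ok m (x : space) := sval x [::] = l /\
  forall i n, n <= m.*2 -> s ((n, restr i n (sval x)) : game i l).

Lemma cover_step m x : ok m x -> exists y, ok m.+1 y /\
  forall r, reduced r -> size r <= m -> sval y r = sval x r.
Proof.
move=> [x0 hx].
have /choice[z hz] : forall i, exists z : space, [/\ sval z [::] = l,
    s ((m.*2.+1, restr i m.*2.+1 (sval z)) : game i l) &
    forall w, reduced w -> size w <= m -> sval z w = sval x w].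
  move=> i; have := (qs i).2 _ (restr_node i m.*2 x0) (hx i _ (leqnn _)).
  rewrite /serves lev_game odd_double eqxx => -[q /child_restr[z [z0 -> hz]] sz].
  by exists z; split=> // w rw sw; apply: hz => //; rewrite time_even.
have hr i : sval (z i) [::] = sval (z 0) [::].
  by case: (hz i) => -> _ _; case: (hz 0) => -> _ _.
exists (glue hr).
have gx r : reduced r -> size r <= m -> sval (glue hr) r = sval x r.
  by move=> rr sr; rewrite glueE //; case: (hz (last_index r)) => _ _ ->.
have g0 : sval (glue hr) [::] = l by rewrite glueE //; case: (hz (last_index [::])).
split=> //; split=> // i n.
(* The words known at this time in game [i] are the old ones, where all [z i] equal [x], and the new
   ones in branch [i], taken from [z i]. *)
have e1 : restr i m.*2.+1 (sval (glue hr)) = restr i m.*2.+1 (sval (z i)).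
  apply/restr_eq => w rw; rewrite time_odd => /orP[sw|/andP[/eqP li sw]].
    by rewrite gx //; case: (hz i) => _ _ ->.
  by rewrite glueE // li.
have s1 : s ((m.*2.+1, restr i m.*2.+1 (sval (glue hr))) : game i l).
  by rewrite e1; case: (hz i).
rewrite doubleS leq_eqVlt => /orP[/eqP ->|].
  have := (qs i).2 _ (restr_node i m.*2.+1 g0) s1.
  rewrite /serves lev_game /= odd_double /=; apply.
  exact: (restr_child i m.*2.+1 g0).
rewrite ltnS leq_eqVlt => /orP[/eqP -> //|].
rewrite ltnS => nm; have := hx i n nm; congr (s _); congr (_, _).
apply/restr_eq => w rw tw; apply/esym/gx => //.
by rewrite -(time_even i) (leq_trans tw).
Qed.

Lemma cover_point : exists x : space, sval x [::] = l /\
  forall i n, s ((n, restr i n (sval x)) : game i l).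
Proof.
pose st m := {x : space | ok m x}.
have s0 : ok 0 (counting l).
  split=> [|i n]; first exact: counting_root.
  rewrite leqn0 => /eqP ->; apply: (qs i).1 => //.
  by apply: restr_node; exact: counting_root.
have step m (x : st m) : exists y : st m.+1,
    forall r, reduced r -> size r <= m -> sval (sval y) r = sval (sval x) r.
  by case: x => x okx /=; have [y [oky hy]] := cover_step okx; exists (exist _ y oky).
pose X := fix X m : st m := if m is m.+1 then sval (cid (step m (X m))) else exist _ _ s0.
have [x hx] := @space_limit (fun m => sval (X m)) (fun m => svalP (cid (step m (X m)))).
have x0 : sval x [::] = l by rewrite (hx 0) //; case: (svalP (X 0)).
exists x; split=> // i n; have [_ /(_ i n)] := svalP (X n).
rewrite -addnn leq_addr => /(_ isT).
suff -> : restr i n (sval (sval (X n))) = restr i n (sval x) by [].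
by apply/restr_eq => w rw /time_size sw; rewrite -hx.
Qed.

End Covering.

(* Strategies of player II for the same [i] are played simultaneously at the three
   vertices of a triangle, each of them providing the moves of player I in the
   games of the other two. *)
Section Orbit.
Variables (i : nat) (L : 'I_3 -> nat -> 'I_3) (s : forall a, game i (L a) -> Prop).
Hypothesis Li : forall a, L a i = a.
Hypothesis qs : forall a, qstrat true (@s a).

Let ok m (x : space) := forall a, sval (shift i a x) [::] = L a /\
  forall n, n <= m.*2.+1 -> s ((n, restr i n (sval (shift i a x))) : game i (L a)).

Lemma orbit_start : exists x, ok 0 x.
Proof.
have hz a : sval (counting (L a)) [::] i = (sval (counting (L 0%R)) [::] i + a)%R.
  by rewrite !counting_root !Li add0r.
exists (triangle hz) => a.
have x0 : sval (shift i a (triangle hz)) [::] = L a.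
  by rewrite triangle_shift; exact: counting_root.
split=> // n; have s0 : s ((0, restr i 0 (sval (shift i a (triangle hz)))) : game i (L a)).
  by apply: (qs a).1 => //; exact: restr_node.
case: n => [//|[_|//]].
have := (qs a).2 _ (restr_node i 0 x0) s0; rewrite /serves /=; apply.
exact: (restr_child i 0 x0).
Qed.

Lemma orbit_step m x : ok m x -> exists y, ok m.+1 y /\
  forall r, reduced r -> size r <= m -> sval y r = sval x r.
Proof.
move=> hx.
have /choice[z hz] : forall a, exists z : space, [/\ sval z [::] = L a,
    s ((m.*2.+2, restr i m.*2.+2 (sval z)) : game i (L a)) &
    forall w, reduced w -> time i w <= m.*2.+1 -> sval z w = sval (shift i a x) w].
  move=> a; have [x0 sx] := hx a.
  have := (qs a).2 _ (restr_node i m.*2.+1 x0) (sx _ (leqnn _)).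
  rewrite /serves lev_game [odd _ == _](_ : _ = true); last by rewrite /= odd_double.
  move=> -[q /child_restr[z [z0 -> hz]] sz].
  by exists z.
have hr a : sval (z a) [::] i = (sval (z 0%R) [::] i + a)%R.
  by case: (hz a) => -> _ _; case: (hz 0%R) => -> _ _; rewrite !Li add0r.
pose y := triangle hr; exists y.
have ye a : restr i m.*2.+2 (sval (shift i a y)) = restr i m.*2.+2 (sval (z a)).
  apply/restr_eq => w rw; rewrite -doubleS time_even => sw; rewrite triangle_shift.
  have [nl|/not_implyP[w0 /contrapT li]] := pselect (w != [::] -> last_index w <> i).
    by rewrite foldr_tpush.
  (* Seen from vertex [a], the word w' g_i^b is the word w' seen from vertex [b + a]. Both were
     labelled before the present moves, so both labels are those of [x]. *)
  have : exists w' b, w = rcons w' (i, b).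
    case/lastP: w w0 li {rw sw} => // w' [j b] _; rewrite /last_index last_rcons /= => <-.
    by exists w', b.
  move=> [w' [b ew]]; have [rw' lw'] : reduced w' /\ (w' != [::] -> last_index w' <> i).
    by apply: (reduced_rcons (c := (i, b))); rewrite -ew.
  rewrite ew foldr_rcons /tpush /= eqxx -/(tpush i) foldr_tpush //=.
  have sw' : size w' <= m by rewrite ew size_rcons ltnS in sw.
  have [_ _ ->] := hz (b + a)%R => //; last by rewrite time_odd sw'.
  have [_ _ ->] := hz a; rewrite -ew //; last first.
    by rewrite time_odd li eqxx sw orbT.
  by rewrite ew -[RHS]/(sval (shift i b (shift i a x)) w') shiftD.
have yx a r : reduced r -> time i r <= m.*2.+1 -> sval (shift i a y) r = sval (shift i a x) r.
  move=> rr tr; have /restr_eq -> // := ye a; last exact: leqW.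
  by case: (hz a) => _ _ ->.
split; last first.
  move=> r rr sr; rewrite -(shift0 i y) -(shift0 i x); apply: yx => //.
  by rewrite time_odd sr.
move=> a; have y0 : sval (shift i a y) [::] = L a by rewrite yx //; case: (hx a).
split=> // n.
have s1 : s ((m.*2.+2, restr i m.*2.+2 (sval (shift i a y))) : game i (L a)).
  by rewrite ye; case: (hz a).
rewrite doubleS leq_eqVlt => /orP[/eqP ->|].
  have := (qs a).2 _ (restr_node i m.*2.+2 y0) s1.
  rewrite /serves lev_game /= odd_double /=; apply.
  exact: (restr_child i m.*2.+2 y0).
rewrite ltnS leq_eqVlt => /orP[/eqP -> //|].
rewrite ltnS => nm; have [_ /(_ n nm)] := hx a; congr (s _); congr (_, _).
by apply/restr_eq => w rw tw; apply/esym/yx => //; exact: leq_trans tw nm.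
Qed.

Lemma orbit_point : exists x : space, forall a, sval (shift i a x) [::] = L a /\
  forall n, s ((n, restr i n (sval (shift i a x))) : game i (L a)).
Proof.
pose st m := {x : space | ok m x}.
have [x0 ok0] := orbit_start.
have step m (x : st m) : exists y : st m.+1,
    forall r, reduced r -> size r <= m -> sval (sval y) r = sval (sval x) r.
  by case: x => x okx /=; have [y [oky hy]] := orbit_step okx; exists (exist _ y oky).
pose X := fix X m : st m := if m is m.+1 then sval (cid (step m (X m))) else exist _ _ ok0.
have [x hx] := @space_limit (fun m => sval (X m)) (fun m => svalP (cid (step m (X m)))).
(* The inequality is strict because a shift lengthens words by one letter. *)
have xE a m r : reduced r -> size r < m ->
    sval (shift i a x) r = sval (shift i a (sval (X m))) r.
  move=> rr sr; rewrite /= -[LHS]space_reduce -[RHS]space_reduce (hx m) ?reduceP //.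
  by rewrite (leq_trans (size_reduce _)) // size_rcons.
exists x => a; split.
  by rewrite (xE a 1) //; case: (svalP (X 1) a).
move=> n; have [_ /(_ n)] := svalP (X n.+1) a.
rewrite -addnn addnS leqW ?leqW ?leq_addr // => /(_ isT).
suff -> : restr i n (sval (shift i a (sval (X n.+1)))) = restr i n (sval (shift i a x)) by [].
by apply/restr_eq => w rw /time_size sw; rewrite -xE.
Qed.

End Orbit.

Theorem monochromatic_triangle (A : nat -> space -> Prop) :
  (forall i l, unravelable (fun p : nat -> game i l => A i (outcome p))) ->
  (forall x, exists i, A i x) ->
  exists i x, forall a, A i (shift i a x).
Proof.
move=> uA cA.
pose win i l := exists s : game i l -> Prop, qstrat true s /\
  forall p, play p -> (forall n, s (p n)) -> A i (outcome p).
have winE l : exists i, win i l.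
  apply: contrapT => nw.
  have lose i : exists s : game i l -> Prop, qstrat false s /\
      forall p, play p -> (forall n, s (p n)) -> ~ A i (outcome p).
    pose x0 := counting l; have x0l : sval x0 [::] = l := counting_root l.
    have [] // := @determinacy _ _ true ((0, restr i 0 (sval x0)) : game i l)
      (restr_node i 0 x0l) erefl _ (uA i l).
    - move=> [n f] [x xl /= ->] n0; have {}n0 : n = 0 := n0.
      rewrite n0; congr (_, _); apply/restr_eq => w _.
      by rewrite -[0]/(0.*2) time_even; case: w => // _; rewrite xl; exact: esym x0l.
    - by case=> s [qs hs]; case: nw; exists i, s.
  pose s i := sval (cid (lose i)).
  have [x [xl xs]] := @cover_point l s (fun i => (svalP (cid (lose i))).1).
  have [i Ai] := cA x.
  apply: (svalP (cid (lose i))).2 (restr_play i xl) (xs i) _.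
  by rewrite outcome_restr.
have [i Hi] : exists i, forall a, exists2 l, l i = a & win i l.
  apply: contrapT => nH.
  (* Diagonal root label: if [a_i] is not the i-th coordinate of any label for
     which II wins with [i], then II does not win with [i] for the label [a]. *)
  have /choice[l hl] : forall i, exists a, forall l, l i = a -> ~ win i l.
    move=> i; apply: contrapT => nh; apply: nH; exists i => a.
    apply: contrapT => na; apply: nh; exists a => l la wl.
    by apply: na; exists l.
  by have [i wi] := winE l; exact: (hl i l).
have /choice[L hL] : forall a, exists l, l i = a /\ win i l.
  by move=> a; have [l la wl] := Hi a; exists l.
pose s a := sval (cid (hL a).2).
have [x hx] := @orbit_point i L s (fun a => (hL a).1) (fun a => (svalP (cid (hL a).2)).1).
exists i, x => a; have [xl xs] := hx a.
rewrite -(outcome_restr i xl).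
exact: (svalP (cid (hL a).2)).2 (restr_play i xl) xs.
Qed.

Lemma outcome_root i l (p : nat -> game i l) : play p -> sval (outcome p) [::] = l.
Proof.
move=> pp; have [[x x0 e] l0 _] := pp 0; have e0 := outcomeE pp 0.
have := congr1 (fun q : game i l => q.2 [::]) e0; rewrite e /restr /= => <-.
by rewrite ?x0.
Qed.

(** A finite set of words has received its labels, with all coordinates, by some finite level; so
    [B] becomes an open set of plays. *)
Lemma unravelable_outcome i l (B : space -> Prop) :
  (forall x, B x -> exists s : seq word,
     forall y : space, (forall w, w \in s -> sval y w = sval x w) -> B y) ->
  unravelable (fun p : nat -> game i l => B (outcome p)).
Proof.
move=> oB; pose U (q : game i l) := forall x : space,
  sval x [::] = l -> q.2 = restr i q.1 (sval x) -> B x.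
apply: unravelable_ext (@unravelable_open _ U) => p pp; split.
  case=> n; apply; first exact: outcome_root.
  by rewrite (outcomeE pp n).
move=> /oB[s hs]; pose n := \max_(w <- s) time i (reduce w); exists n => y y0.
rewrite (outcomeE pp n) /= => /restr_eq h; apply: hs => w ws.
rewrite -[LHS]space_reduce -[RHS]space_reduce h //; first exact: reduceP.
exact: (@leq_bigmax_seq _ _ _ (fun w => time i (reduce w))).
Qed.

(** * The topology of the space and its triangle graphs *)

(** The parameter [R] lets the metric instance find the field of its distances. *)
Definition mspace (R : realType) : Type := space.

Section Metric.
Variable R : realType.
Local Open Scope ring_scope.


HB.instance Definition _ := gen_eqMixin (mspace R).
HB.instance Definition _ := gen_choiceMixin (mspace R).
HB.instance Definition _ := isPointed.Build (mspace R) (counting (fun=> 0)).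

Definition coord (n : nat) (x : mspace R) : 'I_3 :=
  if @pickle_inv (word * nat)%type n is Some (w, j) then sval x w j else 0.

Definition agree (n : nat) (x y : mspace R) := forall m, (m < n)%N -> coord m x = coord m y.

Lemma coord_ext (x y : mspace R) : (forall m, coord m x = coord m y) -> x = y.
Proof.
move=> h; apply: space_ext => w; apply/funext => j.
by have := h (pickle (w, j)); rewrite /coord pickleK_inv.
Qed.

Lemma coord_neq (x y : mspace R) : x != y -> exists n, coord n x != coord n y.
Proof.
move=> /eqP xy; apply: contrapT => h; apply: xy; apply: coord_ext => m.
by apply/eqP/negPn/negP => hm; apply: h; exists m.
Qed.

(* [2 ^ - n], where [n] is the first coordinate at which the points differ. *)
Definition sdist (x y : mspace R) : R :=
  if pselect (x != y) is left h then 2^-1 ^+ ex_minn (coord_neq h) else 0.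

Lemma sdist_le n x y : sdist x y <= 2^-1 ^+ n <-> agree n x y.
Proof.
rewrite /sdist; case: pselect => [h|/negP/negPn/eqP ->]; last first.
  by split=> // _; rewrite exprn_ge0 // invr_ge0.
case: ex_minnP => m hm min; rewrite ler_iXn2l ?invr_gt0 ?invf_lt1 ?ltr1n //.
split=> [nm k kn|ag].
  by apply/eqP/negPn/negP => /min; rewrite leqNgt (leq_trans kn).
by rewrite leqNgt; apply/negP => /ag e; rewrite e eqxx in hm.
Qed.

Let half_small (e : R) : 0 < e -> exists n, 2^-1 ^+ n < e.
Proof.
move=> e0; have [n hn] : exists n : nat, e^-1 < n%:R.
  by exists (Num.bound e^-1); apply: archi_boundP; rewrite invr_ge0 ltW.
exists n; rewrite exprVn invf_plt ?posrE ?exprn_gt0 //.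
by rewrite (lt_trans hn) // -natrX ltr_nat ltn_expl.
Qed.

Let half_gt0 n : 0 < 2^-1 ^+ n :> R.
Proof. by rewrite exprn_gt0 // invr_gt0. Qed.

Let sdistxx x : sdist x x = 0.
Proof. by rewrite /sdist; case: pselect => // h; case: (negP h). Qed.

Let sdist_ge0 x y : 0 <= sdist x y.
Proof. by rewrite /sdist; case: pselect => // h; rewrite exprn_ge0 // invr_ge0. Qed.

Let sdist_pos x y : sdist x y = 0 -> x = y.
Proof.
rewrite /sdist; case: pselect => [h|/negP/negPn/eqP //] /eqP.
by rewrite expf_eq0 invr_eq0 pnatr_eq0 /= andbF.
Qed.

Let sdist_sym x y : sdist x y = sdist y x.
Proof.
suff H (u v : mspace R) : sdist u v <= sdist v u by apply/eqP; rewrite eq_le !H.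
rewrite {2}/sdist; case: pselect => [h|/negP/negPn/eqP ->]; last by rewrite sdistxx.
case: ex_minnP => m hm min; apply/sdist_le => k km.
by apply/esym/eqP/negPn/negP => /min; rewrite leqNgt km.
Qed.

Let sdist_triangle y x z : sdist x z <= sdist x y + sdist y z.
Proof.
rewrite {1}/sdist; case: pselect => [h|_]; last by rewrite addr_ge0 ?sdist_ge0.
case: ex_minnP => m hm min; rewrite leNgt; apply/negP => lt.
have ag (u v : mspace R) : sdist u v < 2^-1 ^+ m -> coord m u = coord m v.
  rewrite /sdist; case: pselect => [h'|/negP/negPn/eqP -> //].
  case: ex_minnP => k hk kmin; rewrite ltr_iXn2l ?invr_gt0 ?invf_lt1 ?ltr1n // => annot.
  by apply/eqP/negPn/negP => /kmin; rewrite leqNgt annot.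
move: hm; rewrite (ag x y) ?(ag y z) ?eqxx //.
  by apply: le_lt_trans lt; rewrite lerDr sdist_ge0.
by apply: le_lt_trans lt; rewrite lerDl sdist_ge0.
Qed.

HB.instance Definition _ := isMetric.Build R (mspace R)
  sdistxx sdist_pos sdist_sym sdist_triangle.

Lemma ball_sdist (x : mspace R) e : ball x e = [set y | sdist x y < e].
Proof. exact: ballEmdist. Qed.

Lemma nbhs_agree (x : mspace R) (B : set (mspace R)) :
  nbhs x B <-> exists n, forall y, agree n x y -> B y.
Proof.
split=> [/nbhs_ballP[e /= e0 eB]|[n nB]].
  have [n hn] := half_small e0; exists n => y xy; apply: eB.
  by rewrite ball_sdist /=; apply: le_lt_trans hn; exact/sdist_le.
apply/nbhs_ballP; exists (2^-1 ^+ n) => /=; first by rewrite exprn_gt0 // invr_gt0.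
by move=> y; rewrite ball_sdist /= => /ltW/sdist_le; exact: nB.
Qed.

Lemma open_agree (B : set (mspace R)) :
  open B <-> forall x, B x -> exists n, forall y, agree n x y -> B y.
Proof.
rewrite openE; split=> h x Bx; first exact/nbhs_agree/h.
exact/nbhs_agree/h.
Qed.

Lemma agree_words (s : seq word) j : exists n, forall x y : mspace R, agree n x y ->
  forall w, w \in s -> sval x w j = sval y w j.
Proof.
exists (\max_(w <- s) pickle (w, j)).+1 => x y xy w ws.
have := xy (pickle (w, j)); rewrite /coord pickleK_inv; apply.
by rewrite ltnS; exact: (@leq_bigmax_seq _ _ _ (fun w => pickle (w, j))).
Qed.

Lemma mspace_separable : separable_space (mspace R).
Proof.
pose P (t : seq 'I_3) (x : mspace R) := forall m, (m < size t)%N -> coord m x = nth 0 t m.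
(* One point is taken for each finite prefix; prefixes of no point yield the default. *)
exists (range (fun t => xget point (P t))).
  exact: card_le_trans (card_image_le _ _) (countableP _).
move=> O [x Ox] /open_agree/(_ x Ox)[n hn].
pose t := mkseq (fun m => coord m x) n.
exists (xget point (P t)); split; last by exists t.
apply: hn => m mn; have Px : P t x.
  by move=> k; rewrite size_mkseq => kn; rewrite nth_mkseq.
have /xgetPex -> // : exists y, P t y by exists x.
  by rewrite nth_mkseq.
by rewrite size_mkseq.
Qed.

Lemma mspace_complete : complete_space (mspace R).
Proof.
move=> F PF cF.
have /choice[z hz] : forall n, exists z : mspace R, F [set y | agree n z y].
  move=> n; have [z hz] := (cauchyP F).1 cF (2^-1 ^+ n) (half_gt0 n).
  exists z; apply: filterS hz => y; rewrite ball_sdist /= => /ltW.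
  by move/sdist_le.
have zz n k : agree (minn n k) (z n) (z k).
  have [y [y1 y2]] := filter_ex (filterI (hz n) (hz k)).
  by move=> m; rewrite leq_min => /andP[mn annot]; rewrite y1 // y2.
pose f : labelling := fun w j => coord (pickle (w, j)) (z (pickle (w, j)).+1).
have fz n w j : (pickle (w, j) < n)%N -> f w j = sval (z n) w j.
  move=> lt; have := @zz (pickle (w, j)).+1 n (pickle (w, j)).
  by rewrite leq_min ltnS leqnn lt /f /coord pickleK_inv => /(_ isT).
have Hf : respects f.
  apply: respects_local => s j; exists (z (\max_(w <- s) pickle (w, j)).+1) => w ws.
  by apply: fz; rewrite ltnS; exact: (@leq_bigmax_seq _ _ _ (fun w => pickle (w, j))).
exists (exist _ f Hf) => B /nbhs_agree[n hn].
apply: filterS (hz n) => y zy; apply: hn => m mn; rewrite -zy // /coord.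
case E : (pickle_inv m) => [[w j]|] //=; apply: fz.
by have := @pickle_invK (word * nat)%type m; rewrite E /= => ->.
Qed.

End Metric.

Section Borel.
Variable R : realType.

Definition bspace := g_sigma_algebraType (@open (mspace R)).

Lemma bspace_standard : standard_borel R bspace.
Proof.
exists (mspace R), id; split=> //.
- exact: mspace_separable.
- exact: mspace_complete.
- by exists id.
Qed.

Lemma measurable_cylinder w j a : measurable [set x : bspace | sval x w j = a].
Proof.
apply: sub_sigma_algebra; apply/open_agree => x /= xa.
have [n hn] := agree_words R [:: w] j; exists n => y /hn h.
by rewrite -h ?inE.
Qed.

Definition triangle_graph i : set (bspace * bspace) :=
  [set p | exists2 a : 'I_3, a != 0%R & p.2 = shift i a p.1].

(** For fixed [a], the graph of the shift is cut out by countably many equations between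
    coordinates, each of them a finite union of rectangles over the common value [c]. *)
Lemma triangle_borel i : borel_graph (triangle_graph i).
Proof.
split.
- have -> : triangle_graph i = \bigcup_(a in [set a : 'I_3 | a != 0%R])
      \bigcap_n \bigcup_(c in [set: 'I_3])
        (if @pickle_inv (word * nat)%type n is Some (w, j) then
          [set x : bspace | sval x (rcons w (i, a)) j = c] `*` [set x : bspace | sval x w j = c]
        else setT).
    apply/seteqP; split=> [[x y] [a a0 /= ->]|[x y] [a a0 h]].
      exists a => // n _; case: pickle_inv => [[w j]|]; last by exists 0%R.
      by exists (sval x (rcons w (i, a)) j).
    exists a => //; apply: space_ext => w; apply/funext => j.
    by have [c _] := h (pickle (w, j)) I; rewrite pickleK_inv => -[/= -> ->].
  apply: fin_bigcup_measurable => // a _; apply: bigcapT_measurable => n.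
  apply: fin_bigcup_measurable => // c _.
  by case: pickle_inv => [[w j]|] //; apply: measurableX; exact: measurable_cylinder.
- move=> x y [a a0 /= ->]; exists (- a)%R; first by rewrite oppr_eq0.
  by rewrite /= shiftD addNr shift0.
- move=> x [a a0 /= e]; move: a0; have := shift_root i a x; rewrite -e.
  by move/eqP; rewrite -subr_eq0 opprD addrA subrr add0r oppr_eq0 => /eqP ->; rewrite eqxx.
Qed.

Lemma shift_inj i a b (x : space) : shift i a x = shift i b x -> a = b.
Proof.
move=> e; have := congr1 (fun y : space => sval y [::] i) e.
by rewrite !shift_root => /addrI.
Qed.

Lemma triangle_two_regular i : two_regular (triangle_graph i).
Proof.
move=> x; rewrite card_eq_sym; apply/card_set_bijP.
exists (fun n => shift i (inord n.+1) x); split.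
- by move=> n /= n2; exists (inord n.+1) => //; apply/eqP => /(congr1 val); rewrite /= inordK.
- move=> m n; rewrite !inE /= => m2 n2 /shift_inj /(congr1 val).
  by rewrite /= !inordK // => -[].
- move=> y [a a0 /= ->]; exists a.-1 => /=.
    by rewrite -ltnS prednK ?lt0n // ltn_ord.
  by congr (shift i _ x); apply: val_inj; rewrite /= inordK prednK ?lt0n // ltn_ord.
Qed.

(** The sets that pull back to unravelable ones form a sigma-algebra containing the open sets. *)
Lemma unravelable_measurable (B : set bspace) i l : measurable B ->
  unravelable (fun p : nat -> game i l => B (outcome p)).
Proof.
move=> mB; have : <<s @open (mspace R) >> B by [].
suff : <<s @open (mspace R) >> `<=`
    [set B : set (mspace R) | unravelable (fun p : nat -> game i l => B (outcome p))].
  by move=> h /h.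
apply: smallest_sub.
  split.
  - apply: unravelable_ext (@unravelable_open (game i l) (fun=> False)) => p _.
    by split=> [[]|[]].
  - move=> A uA; apply: unravelable_ext (unravelable_not uA) => p _.
    by rewrite setTD.
  - move=> A uA; apply: unravelable_ext (@unravelable_union _ (fun n p => A n (outcome p)) uA) => p _.
    by split=> [[n An]|[n _ An]]; exists n.
move=> A /open_agree oA; apply: unravelable_outcome => x /oA[n hn].
exists (pmap (fun m => omap fst (@pickle_inv (word * nat)%type m)) (iota 0 n)) => y h.
apply: hn => m mn; rewrite /coord; case E : (pickle_inv m) => [[w j]|] //.
rewrite h // mem_pmap; apply/mapP; exists m; last by rewrite E.
by rewrite mem_iota.
Qed.

End Borel.

Theorem theorem3p10 (R : realType) :
  exists (d : measure_display) (X : measurableType d) (G : nat -> set (X * X)),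
    [/\ standard_borel R X,
        forall i : nat, borel_graph (G i) /\ two_regular (G i) &
        forall c : nat -> X -> 'I_3,
          (forall i : nat, borel_3coloring (G i) (c i)) ->
          exists x : X, forall i j : nat, c i x = c j x].
Proof.
exists _, (bspace R), (@triangle_graph R); split.
- exact: bspace_standard.
- by move=> i; split; [exact: triangle_borel|exact: triangle_two_regular].
move=> c hc.
have [[x hx]|nx] := pselect (exists x, forall i, c i x = 0%R).
  by exists x => i j; rewrite !hx.
exfalso; pose A i (x : space) := c i x <> 0%R.
have [i l|x|i [x hx]] := @monochromatic_triangle A.
- have [mc _] := hc i.
  apply: (@unravelable_measurable R (c i @^-1` [set a | a <> 0%R])).
  by rewrite -[X in measurable X]setTI; exact: mc.
- by apply: contrapT => h; apply: nx; exists x => i; apply: contrapT => ci; apply: h; exists i.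
have [_ col] := hc i.
have adj a b : a != b -> c i (shift i a x) <> c i (shift i b x).
  move=> ab; apply: col; exists (b - a)%R; first by rewrite subr_eq0 eq_sym.
  by rewrite /= shiftD subrK.
have inj : injective (fun a => c i (shift i a x)).
  by move=> a b e; apply/eqP/negPn/negP => /adj; apply.
have [g _ gK] := injF_bij inj.
by apply: (hx (g 0%R)); rewrite gK.
Qed.
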